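(* Let $\{(X_n,T_n,\varphi_n)\}_{n\ge 0}$ be a one-sided sequence satisfying conditions (A1)–(A4) of the context. Then for all sufficiently large $Q>0$ (i.e. there is $Q_0$ such that for every $Q\ge Q_0$), writing $\Lambda_n=\Lambda_n(Q)$, the following are true. [A] For every $n\ge 0$ and every sequence of measures $\{\sigma_\ell\in M(X_\ell)\}_{\ell\ge n}$, the limits $$\lambda_n=\lim_{k\to\infty}\frac{\langle \mathbf{L}_n^k\mathbf{1},\sigma_{n+k}\rangle}{\langle \mathbf{L}_{n+1}^{k-1}\mathbf{1},\sigma_{n+k}\rangle},\qquad m_n=\lim_{k\to\infty}\frac{(\mathbf{L}_n^k)^*\sigma_{n+k}}{\langle \mathbf{1},(\mathbf{L}_n^k)^*\sigma_{n+k}\rangle}$$ exist (the second in the weak* topology on $M(X_n)$) and are independent of the choice of the sequence $\{\sigma_\ell\}$. [B] Each real number $\lambda_n$ is positive, each $m_n$ is a probability measure, and $L_n^*m_{n+1}=\lambda_n m_n$ for every $n\geq 0$. [C] $(m_n)_{n\ge 0}$ is the unique sequence of Borel probability measures $m_n\in M(X_n)$ with the property that $L_n^*m_{n+1}$ is a scalar multiple of $m_n$ for every $n\ge 0$. [D] There are constants $C_1>0$ and $\gamma\in(0,1)$ such that for any $n\ge 0$, any $k\ge\tau$, any $\sigma\in M(X_{n+k})$, and any $f\in\Lambda_n$, $$\Big|\log\lambda_n-\log\frac{\langle \mathbf{L}_n^k\mathbf{1},\sigma\rangle}{\langle \mathbf{L}_{n+1}^{k-1}\mathbf{1},\sigma\rangle}\Big|\le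 C_1\gamma^k\quad\text{and}\quad \Big|\langle f,m_n\rangle-\frac{\langle f,(\mathbf{L}_n^k)^*\sigma\rangle}{\langle\mathbf{1},(\mathbf{L}_n^k)^*\sigma\rangle}\Big|\le C_1\|f\|\gamma^k.$$
   Context: Setting: for each $n\ge 0$, $(X_n,d_n)$ is a metric space, $T_n\colon X_n\to X_{n+1}$ a map, $\varphi_n\colon X_n\to\mathbb{R}$ a continuous function. Write $\mathbf{T}_n^k=T_{n+k-1}\circ\cdots\circ T_{n+1}\circ T_n\colon X_n\to X_{n+k}$. $B(x,\delta)$ denotes the closed ball of radius $\delta$. ''For all $n$'' means for all $n\ge 0$. (A1) Each $(X_n,d_n)$ is a compact metric space and each $T_n$ is continuous. There exists $D\in\mathbb{N}$ such that $1\le \#T_n^{-1}(x)\le D$ for every $n$ and every $x\in X_{n+1}$. (A2) There exist $\delta>0$ and $\rho\in(0,1)$ such that for all $n$ and all $x,x'\in X_n$ with $d_n(x,x')\le\delta$ we have $d_n(x,x')\le\rho\, d_{n+1}(T_n(x),T_n(x'))$. Moreover, for any $x\in X_n$, $T_n(B(x,\delta))\supset B(T_nx,\delta)$ in $X_{n+1}$. (A3) With $\delta$ as in (A2), there exists $\tau\in\mathbb{N}$ such that for every $n$ and $x\in X_n$, $\mathbf{T}_n^\tau(B(x,\delta))=X_{n+\tau}$. (A4) There exist $H>0$ and $\beta\in(0,1)$ such that for all $n$ and all $x,x'\in X_n$ with $d_n(x,x')\le\delta$, $|\varphi_n(x)-\varphi_n(x')|\le H d_n(x,x')^\beta$. Moreover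 there exists $V>0$ with $\|\varphi_n\|_\infty\le V$ for all $n$. Operators: $L_n\colon C(X_n)\to C(X_{n+1})$ is $(L_nf)(x)=\sum_{y\in T_n^{-1}(x)}e^{\varphi_n(y)}f(y)$, and $\mathbf{L}_n^k=L_{n+k-1}\circ\cdots\circ L_{n+1}\circ L_n\colon C(X_n)\to C(X_{n+k})$ ($\mathbf{L}_n^0$ is the identity). $M(X_n)$ is the set of positive (nonzero) finite Borel measures on $X_n$; $\langle f,m\rangle=\int f\,dm$. The dual operator $L_n^*\colon M(X_{n+1})\to M(X_n)$ is defined by $\langle f,L_n^*m\rangle=\langle L_nf,m\rangle$ for all $f\in C(X_n)$; similarly $(\mathbf{L}_n^k)^*\colon M(X_{n+k})\to M(X_n)$. $\mathbf{1}$ is the constant function $1$, and $\|\cdot\|$ is the sup norm. Cones: $C_n^+=\{f\in C(X_n): f\ge 0,\ f\not\equiv 0\}$ and, for $Q>0$, $$\Lambda_n(Q)=\{f\in C_n^+: f(x)\le e^{Qd_n(x,x')^\beta}f(x')\text{ whenever } d_n(x,x')\le\delta\}.$$ *)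

(* Defs.v *)
From HB Require Import structures.
From mathcomp Require Import all_boot all_order all_algebra.
From mathcomp Require Import all_classical all_reals all_analysis.

Set Implicit Arguments.
Unset Strict Implicit.
Unset Printing Implicit Defensive.

Import Order.TTheory GRing.Theory Num.Theory.
Import numFieldNormedType.Exports.

Local Open Scope classical_set_scope.
Local Open Scope ring_scope.

(* [measurableType] requires a point, so the metric spaces carry one: this only
   says that they are nonempty. *)
#[short(type="pointedMetricType")]
HB.structure Definition PointedMetric (R : numDomainType) :=
  {T of Pointed T & Metric R T}.

(* The type [T] itself, equipped with its Borel sigma-algebra. *)
Notation borel T := (g_sigma_algebraType (@open T)).

(* Tail-recursive addition: [adv n k.+1] and [adv n.+1 k] are convertible, so
   that [X (adv n k.+1)] and [X (adv n.+1 k)] are the same type. *)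
Fixpoint adv (n k : nat) : nat := if k is k'.+1 then adv n.+1 k' else n.

Lemma advE n k : adv n k = (n + k)%N.
Proof. by elim: k n => [|k IHk] n /=; rewrite ?addn0// IHk addSnnS. Qed.

Section Spaces.
Context {R : realType}.

Section OneSpace.
Context {T : pointedMetricType R}.
Implicit Types (f : T -> R).

(* The library's [closed_ball] is the closure of the open ball, which can be
   smaller. *)
Definition cball (x : T) (r : R) : set T := [set y | mdist x y <= r].

Definition supnorm f : R := sup (range (fun x => `|f x|)).

Definition pairing f (m : {measure set (borel T) -> \bar R}) : R :=
  (\int[m]_x f x)%R.

Definition const1 : T -> R := fun=> 1.

(* M(T) is the type of finite measures on [borel T] subject to [nonzero]. *)
Definition nonzero (m : {measure set (borel T) -> \bar R}) : Prop :=
  (0 < m setT)%E.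

(* m' = c m, where [m'] and [m] are compared on Borel sets only: the values of a
   measure on the other subsets are unspecified. *)
Definition proportional (c : R) (m' m : {measure set (borel T) -> \bar R}) :
    Prop :=
  forall A : set (borel T), measurable A -> m' A = (c%:E * m A)%E.

Lemma pairing1_inv_ge0 (m : {measure set (borel T) -> \bar R}) :
  0 <= (pairing const1 m)^-1.
Proof. by rewrite invr_ge0; apply: Rintegral_ge0 => x _; exact: ler01. Qed.

Definition normalized (m : {measure set (borel T) -> \bar R}) :
    {measure set (borel T) -> \bar R} :=
  mscale (NngNum (pairing1_inv_ge0 m)) m.

Definition weakstar_cvg (mu : nat -> {measure set (borel T) -> \bar R})
    (m : {measure set (borel T) -> \bar R}) : Prop :=
  forall f, continuous f -> (fun k => pairing f (mu k)) @ \oo --> pairing f m.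

Definition cone (delta beta Q : R) : set (T -> R) :=
  [set f : T -> R | [/\ continuous f, forall x, 0 <= f x, exists x, f x != 0 &
    forall x x', mdist x x' <= delta ->
      f x <= expR (Q * mdist x x' `^ beta) * f x']].

End OneSpace.

Section Operators.
Context {S T : pointedMetricType R}.

Definition transfer (F : S -> T) (phi : S -> R) (f : S -> R) : T -> R :=
  fun x => \sum_(y \in F @^-1` [set x]) expR (phi y) * f y.

Definition is_dual (L : (S -> R) -> T -> R)
    (m : {finite_measure set (borel T) -> \bar R})
    (nu : {finite_measure set (borel S) -> \bar R}) : Prop :=
  forall f : S -> R, continuous f -> pairing f nu = pairing (L f) m.

(* The finite Borel measure characterised by duality; on compact spaces it exists
   when [L] is positive, linear and preserves continuity, and its values on Borel
   sets are then unique. [mzero] is a junk value. *)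
Definition dual (L : (S -> R) -> T -> R)
    (m : {finite_measure set (borel T) -> \bar R}) :
    {finite_measure set (borel S) -> \bar R} :=
  if pselect (exists nu, is_dual L m nu) is left e then projT1 (cid e)
  else mzero.

End Operators.

Section Sequences.
Variables (X : nat -> pointedMetricType R) (T : forall n, X n -> X n.+1).
Variable phi : forall n, X n -> R.

Fixpoint iterT n k : X n -> X (adv n k) :=
  if k is k'.+1 then fun x => @iterT n.+1 k' (T x) else id.

Definition opL n : (X n -> R) -> X n.+1 -> R := transfer (@T n) (@phi n).

Fixpoint iterL n k : (X n -> R) -> X (adv n k) -> R :=
  if k is k'.+1 then fun f => @iterL n.+1 k' (opL f) else id.

Definition condA1 (D : nat) : Prop :=
  [/\ forall n, compact [set: X n],
      forall n, continuous (@T n) &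
      forall n (x : X n.+1), (`I_1 #<= @T n @^-1` [set x])%card /\
        (@T n @^-1` [set x] #<= `I_D)%card].

Definition condA2 (delta rho : R) : Prop :=
  [/\ 0 < delta, 0 < rho < 1,
      forall n (x x' : X n), mdist x x' <= delta ->
        mdist x x' <= rho * mdist (T x) (T x') &
      forall n (x : X n), cball (T x) delta `<=` @T n @` cball x delta].

Definition condA3 (delta : R) (tau : nat) : Prop :=
  (0 < tau)%N /\
  forall n (x : X n), @iterT n tau @` cball x delta = [set: X (adv n tau)].

Definition condA4 (delta H beta V : R) : Prop :=
  [/\ 0 < H, 0 < beta < 1, 0 < V,
      forall n (x x' : X n), mdist x x' <= delta ->
        `|phi x - phi x'| <= H * mdist x x' `^ beta &
      forall n, supnorm (@phi n) <= V].

End Sequences.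
End Spaces.

Arguments const1 {R} T.
Arguments iterT {R X} T n k.
Arguments opL {R X} T phi n.
Arguments iterL {R X} T phi n k.

(* Main.v *)
Require Import Defs.
From HB Require Import structures.
From mathcomp Require Import all_boot all_order all_algebra finmap.
From mathcomp Require Import all_classical all_reals all_analysis.
From mathcomp Require Import measurable_realfun ring lra.

Set Implicit Arguments.
Unset Strict Implicit.
Unset Printing Implicit Defensive.

Import Order.TTheory GRing.Theory Num.Theory.
Import numFieldNormedType.Exports.

Local Open Scope classical_set_scope.
Local Open Scope ring_scope.

(** Write [L^k] for the [k]-step transfer operator [iterL T phi n k].  The theorem
    rests on one fact: for [f] in the cone, the ratio [L^k f / L^k 1] becomes
    constant exponentially fast in [k], uniformly in [n] ([contraction]).
    A quotient of pairings [<L^k f, sigma> / <L^k 1, sigma>] lies between the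
    extrema of this ratio whatever [sigma] is, which gives the limits, their
    independence of [sigma], and the rates.

    The contraction is obtained by direct subtraction, without a projective
    metric.  Expansion improves regularity, so that for [Q] large every [L] maps
    the cone of exponent [Q] into the cone of a smaller exponent [q * Q]
    ([transfer_qcone]).  By the covering condition, after [tau] steps each point
    feels the maximum of [f / g], and [L^tau f] dominates a fixed proportion of
    that maximum times [L^tau g].  The room between [q * Q] and [Q] allows one to
    subtract a fixed part of it and to stay in the cone ([qcone_sub]): what is
    left has a smaller ratio to [L^tau g], by a constant factor ([one_step]).

    The limit [limit_ratio f] extends to continuous [f], since Lipschitz functions
    are uniformly dense and belong to the cone up to an additive constant.  It is
    a positive linear functional with value 1 at 1, hence the integral against a
    probability measure [m n] by [riesz_representation]; the same theorem provides
    the dual measures.  Applying the definition to [L f] one step later shows that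
    [limit_ratio (L f) = conformal_factor * limit_ratio f], which is the
    conformality of the measures [m n].  Conversely, a conformal sequence [m']
    satisfies [<f, m' n> = <L^k f, m' (n + k)> / <L^k 1, m' (n + k)>] for all [k],
    and the right-hand side tends to [limit_ratio f] ([conformal_unique]). *)

(** * Metric spaces: compactness and Lipschitz regularisation *)

Section MetricTools.
Context {R : realType} {T : pointedMetricType R}.
Implicit Types (f g : T -> R) (x y : T).

Lemma nbhs_mdist x (P : set T) :
  nbhs x P <-> exists2 d, 0 < d & forall y, mdist x y < d -> P y.
Proof.
by rewrite -metricType_numDomainType.filter_from_mdist_nbhs.
Qed.

Lemma continuous_mdistP f : continuous f <->
  forall x e, 0 < e ->
    exists2 d, 0 < d & forall y, mdist x y < d -> `|f x - f y| < e.
Proof.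
split=> [cf x e e0|cf x].
  by have /cvgrPdist_lt/(_ e e0)/nbhs_mdist := cf x.
by apply/cvgrPdist_lt => e e0; apply/nbhs_mdist; exact: cf.
Qed.

Lemma lipschitz_continuous f k : 0 <= k ->
  (forall x y, `|f x - f y| <= k * mdist x y) -> continuous f.
Proof.
move=> k0 fk; apply/continuous_mdistP => x e e0.
exists (e / (k + 1)); first by rewrite divr_gt0// ltr_wpDl.
move=> y; rewrite ltr_pdivlMr ?ltr_wpDl// => xy; apply: le_lt_trans (fk x y) _.
apply: le_lt_trans xy; rewrite mulrC ler_wpM2l ?mdist_ge0// lerDl//.
Qed.

Hypothesis cT : compact [set: T].

Lemma continuous_attains_max f : continuous f -> exists c, forall x, f x <= f c.
Proof.
move=> cf; have [||c _ h] := @compact_EVT_max T R f setT _ cT.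
- by exists point.
- exact: continuous_subspaceT.
- by exists c => x; apply: h; rewrite inE.
Qed.

Lemma continuous_attains_min f : continuous f -> exists c, forall x, f c <= f x.
Proof.
move=> cf; have [||c _ h] := @compact_EVT_min T R f setT _ cT.
- by exists point.
- exact: continuous_subspaceT.
- by exists c => x; apply: h; rewrite inE.
Qed.

Lemma le_supnorm f x : continuous f -> `|f x| <= supnorm f.
Proof.
move=> cf; apply: ub_le_sup; last by exists x.
have [c fc] : exists c, forall y, `|f y| <= `|f c|.
  apply: continuous_attains_max => y; apply: continuous_comp; first exact: cf.
  exact: norm_continuous.
by exists `|f c| => _ [y _ <-].
Qed.

Lemma supnorm_ge0 f : continuous f -> 0 <= supnorm f.
Proof. by move=> cf; exact: le_trans (normr_ge0 _) (le_supnorm point cf). Qed.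

Lemma supnorm_le f b : (forall x, `|f x| <= b) -> supnorm f <= b.
Proof.
by move=> fb; apply: ge_sup => [|_ [x _ <-]//]; exists `|f point|; exists point.
Qed.

(** Compactness in the form used twice below: once for uniform continuity and
    once for Dini's argument. *)
Lemma increasing_cover (U : nat -> set T) :
  (forall n, open (U n)) -> (forall m n, (m <= n)%N -> U m `<=` U n) ->
  (forall x, exists n, U n x) -> exists n, forall x, U n x.
Proof.
move=> oU ndU cU; move: cT; rewrite compact_cover.
move=> /(_ nat setT U (fun n _ => oU n)) [|D _ DU].
  by move=> x _; have [n Ux] := cU x; exists n.
exists (\max_(i <- finmap.enum_fset D) i)%N => x; have [i iD Uix] := DU x I.
by apply: ndU Uix; exact: leq_bigmax_seq.
Qed.

Lemma uniform_continuous_mdist f : continuous f -> forall e, 0 < e ->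
  exists2 d, 0 < d & forall x y, mdist x y < d -> `|f x - f y| < e.
Proof.
move=> /continuous_mdistP cf e e0.
pose U n := [set x | exists2 d, n.+1%:R^-1 < d &
  forall y, mdist x y < d -> `|f x - f y| < e / 2]°.
have [||x|n Un] := @increasing_cover U.
- by move=> n; exact: open_interior.
- move=> m n mn; apply: interiorS => x [d md df]; exists d => //.
  by apply: le_lt_trans md; rewrite lef_pV2 ?posrE// ler_nat.
- have [d d0 df] := cf x (e / 4) (divr_gt0 e0 (ltr0n R 4)).
  have [n nd] : exists n, n.+1%:R^-1 < d / 2.
    have /ltr_add_invr[n] : 0 < d / 2 by rewrite divr_gt0.
    by rewrite add0r; exists n.
  exists n; apply/nbhs_mdist.
  exists (d / 2); first by rewrite /= divr_gt0.
  move=> z /= xz; exists (d / 2) => // y zy.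
  have xy : mdist x y < d.
    by rewrite (splitr d) (le_lt_trans (metric_triangle x z y))// ltrD.
  have /df fz : mdist x z < d by lra.
  have fy := df y xy.
  rewrite (_ : f z - f y = (f x - f y) - (f x - f z)); last by ring.
  by apply: le_lt_trans (ler_normB _ _) _; lra.
exists n.+1%:R^-1; first by rewrite invr_gt0.
move=> x y xy; have [d nd df] := interior_subset (Un x).
apply: lt_trans (df y _) _; last by lra.
exact: lt_trans xy _.
Qed.

(** The largest [k]-Lipschitz function below [f].  It serves to approximate
    continuous functions uniformly, and indicators of open sets from below. *)
Definition inf_convolution (k : nat) f x : R :=
  inf (range (fun y => f y + k%:R * mdist x y)).

Section LipReg.
Variables (f : T -> R) (b : R).
Hypothesis fb : forall x, `|f x| <= b.

Let lb k x : has_inf (range (fun y => f y + k%:R * mdist x y)).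
Proof.
split; first by exists (f x + k%:R * mdist x x); exists x.
exists (- b) => _ [y _ <-]; rewrite -[leLHS]addr0 lerD//.
  by have := fb y; rewrite ler_norml => /andP[].
by rewrite mulr_ge0// mdist_ge0.
Qed.

Lemma inf_convolution_le k x y :
  inf_convolution k f x <= f y + k%:R * mdist x y.
Proof. by apply: ge_inf; [case: (lb k x)|exists y]. Qed.

Lemma inf_convolution_le_id k x : inf_convolution k f x <= f x.
Proof. by have := inf_convolution_le k x x; rewrite mdistxx mulr0 addr0. Qed.

Lemma le_inf_convolution k x c : (forall y, c <= f y + k%:R * mdist x y) ->
  c <= inf_convolution k f x.
Proof.
move=> h; apply: lb_le_inf; first by case: (lb k x).
by move=> _ [y _ <-].
Qed.

Lemma inf_convolution_lipschitz k x y :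
  `|inf_convolution k f x - inf_convolution k f y| <= k%:R * mdist x y.
Proof.
have h u v : inf_convolution k f u <= inf_convolution k f v + k%:R * mdist u v.
  rewrite -lerBlDr; apply: le_inf_convolution => w; rewrite lerBlDr.
  apply: le_trans (inf_convolution_le k u w) _; rewrite -addrA lerD2l -mulrDr.
  by rewrite ler_wpM2l// addrC metric_triangle.
rewrite ler_distl lerBlDr h/=.
by rewrite metric_sym h.
Qed.

Lemma inf_convolution_continuous k : continuous (inf_convolution k f).
Proof. apply: (@lipschitz_continuous _ k%:R) => // x y;
  exact: inf_convolution_lipschitz. Qed.

Lemma inf_convolution_mono m n x : (m <= n)%N ->
  inf_convolution m f x <= inf_convolution n f x.
Proof.
move=> mn; apply: le_inf_convolution => y;
  apply: le_trans (inf_convolution_le m x y) _.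
by rewrite lerD2l ler_wpM2r ?mdist_ge0// ler_nat.
Qed.

(** Outside the ball of radius [d] the penalty [k * d] outweighs the
    oscillation [2 * b] of [f], so that only the ball matters. *)
Lemma inf_convolution_ge k x d c : 0 < d -> c <= b -> 2 * b <= k%:R * d ->
  (forall y, mdist x y < d -> c <= f y) -> c <= inf_convolution k f x.
Proof.
move=> d0 cb kd h; apply: le_inf_convolution => y;
  case: (ltP (mdist x y) d) => xy.
  by rewrite -[leLHS]addr0 lerD ?h// mulr_ge0// mdist_ge0.
have : - b <= f y by have := fb y; rewrite ler_norml => /andP[].
have : k%:R * d <= k%:R * mdist x y by rewrite ler_wpM2l.
lra.
Qed.

End LipReg.

Lemma inf_convolution_approx f e : continuous f -> 0 < e ->
  exists k, forall x, f x - e <= inf_convolution k f x <= f x.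
Proof.
move=> cf e0; have [d d0 df] := uniform_continuous_mdist cf e0.
have fb x : `|f x| <= supnorm f by exact: le_supnorm.
have [k kd] : exists k : nat, 2 * supnorm f <= k%:R * d.
  exists (Num.truncn (2 * supnorm f / d)).+1; rewrite -ler_pdivrMr//.
  by apply/ltW; exact: truncnS_gt.
exists k => x; rewrite (inf_convolution_le_id fb) andbT.
apply: (inf_convolution_ge fb d0) => //.
  by have := fb x; rewrite ler_norml => /andP[_]; lra.
by move=> y /df; rewrite ltr_norml => /andP[]; lra.
Qed.

End MetricTools.

(** * Integrals of continuous functions determine a finite Borel measure *)

Section BorelMeasures.
Context {R : realType} {T : pointedMetricType R}.
Hypothesis cT : compact [set: T].
Implicit Types (f g : T -> R) (U : set T).
Implicit Type m : {measure set (borel T) -> \bar R}.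

Lemma open_borel U : open U -> measurable (U : set (borel T)).
Proof. exact: sub_sigma_algebra. Qed.

Lemma measurable_continuous f : continuous f ->
  measurable_fun [set: borel T] (f : borel T -> R).
Proof.
move=> /continuousP cf; apply: (measurability _ (RGenOInfty.measurableE R)).
move=> _ [_ [a ->] <-]; rewrite setTI; apply: open_borel.
by apply: cf; rewrite set_itvE; exact: open_gt.
Qed.

Lemma integrable_continuous m f : (m setT < +oo)%E -> continuous f ->
  m.-integrable setT (EFin \o (f : borel T -> R)).
Proof.
move=> moo cf; apply: measurable_bounded_integrable => //.
  exact: measurable_continuous.
exists (supnorm f); split; first exact: num_real.
by move=> y /ltW sy x _ /=; rewrite (le_trans _ sy)// le_supnorm.
Qed.

Section FiniteMeasure.
Variable m : {measure set (borel T) -> \bar R}.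
Hypothesis moo : (m setT < +oo)%E.

Lemma pairingD f g : continuous f -> continuous g ->
  pairing (fun x => f x + g x) m = pairing f m + pairing g m.
Proof. by move=> cf cg; apply: RintegralD => //; exact: integrable_continuous.
Qed.

Lemma pairingZ c f : continuous f ->
  pairing (fun x => c * f x) m = c * pairing f m.
Proof. by move=> cf; apply: RintegralZl => //; exact: integrable_continuous.
Qed.

Lemma pairing_ge0 f : (forall x, 0 <= f x) -> 0 <= pairing f m.
Proof. by move=> f0; apply: Rintegral_ge0 => x _; exact: f0. Qed.

Lemma le_pairing f g : continuous f -> continuous g ->
  (forall x, f x <= g x) -> pairing f m <= pairing g m.
Proof.
move=> cf cg fg; apply: le_Rintegral => //; exact: integrable_continuous.
Qed.

Lemma pairing_cst c : pairing (fun=> c) m = c * fine (m setT).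
Proof. exact: Rintegral_cst. Qed.

Lemma pairing1 : pairing (const1 T) m = fine (m setT).
Proof. by rewrite pairing_cst mul1r. Qed.

Lemma pairing_indic (A : set (borel T)) : measurable A ->
  pairing \1_A m = fine (m A).
Proof. by move=> mA; rewrite /pairing /Rintegral integral_indic// setIT. Qed.

Lemma integrable_indic (A : set (borel T)) : measurable A ->
  m.-integrable setT (EFin \o (\1_A : borel T -> R)).
Proof.
move=> mA; apply: measurable_bounded_integrable => //.
exists 1; split; first exact: num_real.
move=> y /ltW y1 x _ /=; apply: le_trans y1.
by rewrite indicE; case: (_ \in _); rewrite ?normr1 ?normr0.
Qed.

Lemma pairing_le_measure f (A : set (borel T)) : continuous f -> measurable A ->
  (forall x, f x <= \1_A x) -> pairing f m <= fine (m A).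
Proof.
move=> cf mA fA; rewrite -pairing_indic//; apply: le_Rintegral => //.
- exact: integrable_continuous.
- exact: integrable_indic.
Qed.

Lemma measure_le_pairing f (A : set (borel T)) : continuous f -> measurable A ->
  (forall x, \1_A x <= f x) -> fine (m A) <= pairing f m.
Proof.
move=> cf mA fA; rewrite -pairing_indic//; apply: le_Rintegral => //.
- exact: integrable_indic.
- exact: integrable_continuous.
Qed.

Lemma pairing_gt0 f : (0 < m setT)%E -> continuous f -> (forall x, 0 < f x) ->
  0 < pairing f m.
Proof.
move=> m0 cf f0; have [c fc] := continuous_attains_min cT cf.
apply: (@lt_le_trans _ _ (pairing (fun=> f c) m)).
  by rewrite pairing_cst mulr_gt0// fine_gt0// m0.
by apply: le_pairing => //; exact: cst_continuous.
Qed.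

End FiniteMeasure.

(** Scaling a measure scales the integrals of non-negative functions; adding
    its sup norm to [f] reduces the general case to that one. *)
Lemma pairing_mscale m (r : {nonneg R}) f : (m setT < +oo)%E -> continuous f ->
  pairing f (mscale r m) = r%:num * pairing f m.
Proof.
move=> moo cf.
have noo : (mscale r m setT < +oo)%E.
  by rewrite /mscale/= lte_mul_pinfty.
have h g : continuous g -> (forall x, 0 <= g x) ->
    pairing g (mscale r m) = r%:num * pairing g m.
  move=> cg g0; rewrite /pairing /Rintegral ge0_integral_mscale//=.
  - rewrite fineM//=.
    by apply: integrable_fin_num => //; exact: integrable_continuous.
  - by apply/measurable_EFinP; exact: measurable_continuous.
  - by move=> x _; rewrite lee_fin.
have cs : continuous (fun _ : T => supnorm f) by exact: cst_continuous.
have cfs : continuous (fun x => f x + supnorm f).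
  by move=> x; apply: continuousD; [exact: cf|exact: cs].
have := h (fun x => f x + supnorm f) cfs.
rewrite !pairingD// (h (fun=> supnorm f))//; last first.
  by move=> x; exact: supnorm_ge0.
rewrite mulrDr => /(_ _)/addIr; apply => x.
by have := le_supnorm cT x cf; rewrite ler_norml => /andP[]; lra.
Qed.

Lemma pairing_normalized m f : (m setT < +oo)%E -> continuous f ->
  pairing f (normalized m) = pairing f m / pairing (const1 T) m.
Proof. by move=> moo cf; rewrite pairing_mscale// mulrC. Qed.

Lemma eq_pairing m m' f :
  (forall A : set (borel T), measurable A -> m A = m' A) ->
  pairing f m = pairing f m'.
Proof.
by move=> mm'; congr fine; apply: eq_measure_integral => A mA _; exact: mm'.
Qed.

Lemma finite_measure_lty (n : {finite_measure set (borel T) -> \bar R}) :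
  (n setT < +oo)%E.
Proof. exact/fin_num_fun_lty/fin_num_measure. Qed.

Lemma norm_indic_le1 U x : `|\1_U x : R| <= 1.
Proof. by rewrite indicE; case: (_ \in _); rewrite ?normr1 ?normr0. Qed.

Lemma bump_bound U k x : 0 <= (inf_convolution k \1_U x : R) <= \1_U x.
Proof.
rewrite (inf_convolution_le_id (norm_indic_le1 U)) andbT.
apply: (le_inf_convolution (norm_indic_le1 U)) => y.
by rewrite addr_ge0 ?mulr_ge0 ?mdist_ge0// indicE.
Qed.

Lemma bump_continuous U k : continuous (inf_convolution k \1_U : T -> R).
Proof. exact: (inf_convolution_continuous (norm_indic_le1 U)). Qed.

Lemma bump_eq1 U x : open U -> U x ->
  exists k0, forall k, (k0 <= k)%N -> inf_convolution k \1_U x = 1 :> R.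
Proof.
move=> oU Ux; have /nbhs_mdist[d d0 dU] := open_nbhs_nbhs (conj oU Ux).
exists (Num.truncn (2 / d)).+1 => k k0k.
apply/eqP; rewrite eq_le; apply/andP; split.
  have /andP[_] := bump_bound U k x.
  by rewrite indicE mem_set.
apply: (inf_convolution_ge (norm_indic_le1 U) d0) => //.
  rewrite mulr1 -ler_pdivrMr//; apply/ltW/(lt_le_trans (truncnS_gt _)).
  by rewrite ler_nat.
by move=> y /dU Uy; rewrite indicE mem_set.
Qed.

(** The regularised indicators of an open set [U] increase to 1 on [U], so the
    sets [F k] where they reach 1 exhaust [U] and one measure of [F k] is at
    most the other measure of [U].  This settles open sets, which are stable
    under intersection and generate the Borel sets. *)
Lemma measure_ext m m' : (m setT < +oo)%E -> (m' setT < +oo)%E ->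
  (forall f, continuous f -> pairing f m = pairing f m') ->
  forall A : set (borel T), measurable A -> m A = m' A.
Proof.
move=> moo m'oo mm'.
have fn (n : {measure set (borel T) -> \bar R}) (A : set (borel T)) :
    (n setT < +oo)%E -> measurable A -> n A = (fine (n A))%:E.
  move=> noo mA; rewrite fineK// ge0_fin_numE//; apply: le_lt_trans noo.
  by apply: le_measure; rewrite ?inE.
have le_open (n n' : {measure set (borel T) -> \bar R}) U : (n setT < +oo)%E ->
    (n' setT < +oo)%E -> (forall f, continuous f ->
      pairing f n = pairing f n') ->
    open U -> (n U <= n' U)%E.
  move=> noo n'oo nn' oU.
  pose F k : set (borel T) := [set x | 1 <= inf_convolution k \1_U x :> R].
  have mF k : measurable (F k).
    have -> : F k =
        setT `&` (inf_convolution k \1_U : borel T -> R) @^-1` `[1, +oo[%classic.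
      by apply/seteqP; split=> x; rewrite /F/= in_itv/= andbT// => -[].
    exact: (measurable_continuous (@bump_continuous U k)).
  have FU : \bigcup_k F k = U.
    apply/seteqP; split=> [x [k _]|x Ux].
      rewrite /F/= leNgt; have /andP[_] := bump_bound U k x.
      rewrite indicE; case: (boolP (x \in U)) => [/set_mem//|_] /= h1 /negP[].
      exact: le_lt_trans h1 ltr01.
    by have [k hk] := bump_eq1 oU Ux; exists k => //; rewrite /F/= hk.
  have ndF : nondecreasing_seq F.
    move=> i j ij; apply/subsetPset => x /= /le_trans; apply.
    exact: (inf_convolution_mono (norm_indic_le1 U)).
  have cF : (n \o F) @ \oo --> n U.
    rewrite -FU; apply: nondecreasing_cvg_mu => //; exact: bigcupT_measurable.
  rewrite -(cvg_lim _ cF)//; apply: lime_le; first by apply/cvg_ex;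
    exists (n U).
  near=> k; rewrite /= (fn _ _ noo (mF k)) (fn _ _ n'oo (open_borel oU))
    lee_fin.
  apply: (@le_trans _ _ (pairing (inf_convolution k \1_U) n)).
    apply: measure_le_pairing => //; first exact: bump_continuous.
    move=> x; rewrite indicE; case: (boolP (x \in F k)) => [/set_mem//|_].
    by have /andP[] := bump_bound U k x.
  rewrite nn'; last exact: bump_continuous.
  apply: pairing_le_measure => //; first exact: bump_continuous.
    exact: open_borel.
  by move=> x; have /andP[] := bump_bound U k x.
have mm'o U : open U -> m U = m' U.
  move=> oU; apply/eqP; rewrite eq_le !le_open// => f cf.
  by rewrite mm'.
move=> A mA.
apply: (@g_sigma_algebra_measure_unique _ R (borel T) (@open T) _ (fun=> setT))
  => //.
- by move=> U; exact: open_borel.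
- by move=> _; exact: openT.
- by apply/seteqP; split=> // x _; exists 0%N.
- exact: openI.
Unshelve. all: by end_near. Qed.

End BorelMeasures.

(** * The Riesz representation theorem on a compact metric space *)

Lemma mnormalizeE d (T : measurableType d) (R : realType)
  (mu : {measure set T -> \bar R}) (P : probability T R) (A : set T) :
  mu setT = 1%E -> mnormalize mu P A = mu A.
Proof. by move=> mu1; rewrite /mnormalize mu1 onee_eq0/= invr1 mule1. Qed.

Section Riesz.
Context {R : realType} {T : pointedMetricType R}.
Hypothesis cT : compact [set: T].
Implicit Types (f g : T -> R) (U V : set T).

Definition positive_functional (Lam : (T -> R) -> R) :=
  [/\ forall f g, continuous f -> continuous g ->
        Lam (fun x => f x + g x) = Lam f + Lam g,
      forall c f, continuous f -> Lam (fun x => c * f x) = c * Lam f &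
      forall f, continuous f -> (forall x, 0 <= f x) -> 0 <= Lam f].

Lemma continuous_add f g : continuous f -> continuous g ->
  continuous (fun x => f x + g x).
Proof. by move=> cf cg x; apply: continuousD; [exact: cf|exact: cg]. Qed.

Lemma continuous_scale c f : continuous f -> continuous (fun x => c * f x).
Proof. by move=> cf x; apply: continuousM; [exact: cst_continuous|exact: cf].
Qed.

Lemma continuous_cst (c : R) : continuous (fun _ : T => c).
Proof. exact: cst_continuous. Qed.

Lemma continuous_sub f g : continuous f -> continuous g ->
  continuous (fun x => f x - g x).
Proof. by move=> cf cg x; apply: continuousB; [exact: cf|exact: cg]. Qed.

Lemma continuous_sum (F : nat -> T -> R) n : (forall i, continuous (F i)) ->
  continuous (fun x => \sum_(i < n) F i x).
Proof.
move=> cF; elim: n => [|n IH].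
  under eq_fun do rewrite big_ord0; exact: continuous_cst.
under eq_fun do rewrite big_ord_recr/=; exact: continuous_add.
Qed.

Lemma open_lt f g : continuous f -> continuous g -> open [set x | f x < g x].
Proof.
move=> cf cg; have /continuousP/(_ [set y | 0 < y] (@open_gt _ 0)) :=
  continuous_sub cg cf.
by congr open; apply/seteqP; split=> x /=; rewrite subr_gt0.
Qed.

Section Positive.
Variable Lam : (T -> R) -> R.
Hypothesis posL : positive_functional Lam.

Let LD f g : continuous f -> continuous g ->
  Lam (fun x => f x + g x) = Lam f + Lam g.
Proof. by case: posL => h _ _; exact: h. Qed.

Let LZ c f : continuous f -> Lam (fun x => c * f x) = c * Lam f.
Proof. by case: posL => _ h _; exact: h. Qed.

Let L0 f : continuous f -> (forall x, 0 <= f x) -> 0 <= Lam f.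
Proof. by case: posL => _ _ h; exact: h. Qed.

Lemma functional_cst c : Lam (fun=> c) = c * Lam (fun=> 1).
Proof.
by rewrite -LZ; [congr Lam; apply/funext => x;
  rewrite mulr1|exact: continuous_cst].
Qed.

Lemma functionalB f g : continuous f -> continuous g ->
  Lam (fun x => f x - g x) = Lam f - Lam g.
Proof.
move=> cf cg; apply/eqP; rewrite eq_sym subr_eq -LD//;
  last exact: continuous_sub.
by apply/eqP; congr Lam; apply/funext => x; rewrite subrK.
Qed.

Lemma functional_le f g : continuous f -> continuous g ->
  (forall x, f x <= g x) -> Lam f <= Lam g.
Proof.
move=> cf cg fg; rewrite -subr_ge0 -functionalB// L0//;
  first exact: continuous_sub.
by move=> x; rewrite subr_ge0.
Qed.

Lemma functional_sum (F : nat -> T -> R) n : (forall i, continuous (F i)) ->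
  Lam (fun x => \sum_(i < n) F i x) = \sum_(i < n) Lam (F i).
Proof.
move=> cF; elim: n => [|n IH].
  under eq_fun do rewrite big_ord0.
  by rewrite functional_cst mul0r big_ord0.
under eq_fun do rewrite big_ord_recr/=.
by rewrite LD ?IH ?big_ord_recr//; exact: continuous_sum.
Qed.

End Positive.

Lemma pairing_positive (m : {measure set (borel T) -> \bar R}) :
  (m setT < +oo)%E -> positive_functional (fun f => pairing f m).
Proof.
move=> moo; split=> *; [exact: pairingD|exact: pairingZ|exact: pairing_ge0].
Qed.

Section Content.
Variable Lam : (T -> R) -> R.
Hypothesis posL : positive_functional Lam.

Let LD f g : continuous f -> continuous g ->
  Lam (fun x => f x + g x) = Lam f + Lam g.
Proof. by case: posL => h _ _; exact: h. Qed.

Let L0 f : continuous f -> (forall x, 0 <= f x) -> 0 <= Lam f.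
Proof. by case: posL => _ _ h; exact: h. Qed.

Let L1_ge0 : 0 <= Lam (fun=> 1).
Proof. by apply: L0 => //; exact: continuous_cst. Qed.

Definition subordinate U f :=
  continuous f /\ forall x, 0 <= f x <= \1_U x.

(** The value that a measure representing [Lam] must give to an open set. *)
Definition inner_content U : R := sup (Lam @` subordinate U).

Lemma subordinate0 U : subordinate U (fun=> 0).
Proof.
split; first exact: continuous_cst.
by move=> x; rewrite lexx/= indicE.
Qed.

Lemma subordinate_le1 U f x : subordinate U f -> f x <= 1.
Proof.
case=> _ /(_ x)/andP[_ /le_trans]; apply.
by rewrite indicE; case: (_ \in _).
Qed.

Lemma subordinate_le U f : subordinate U f -> Lam f <= Lam (fun=> 1).
Proof.
move=> sf; case: (sf) => cf _; apply: functional_le => //.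
  exact: continuous_cst.
by move=> x; exact: subordinate_le1 sf.
Qed.

Lemma has_sup_subordinate U : has_sup (Lam @` subordinate U).
Proof.
split; first by exists (Lam (fun=> 0)), (fun=> 0) => //; exact: subordinate0.
by exists (Lam (fun=> 1)) => _ [f sf <-]; exact: subordinate_le sf.
Qed.

Lemma le_inner_content U f : subordinate U f -> Lam f <= inner_content U.
Proof.
by move=> sf; apply: ub_le_sup; [case: (has_sup_subordinate U)|exists f].
Qed.

Lemma inner_content_le U c : (forall f, subordinate U f -> Lam f <= c) ->
  inner_content U <= c.
Proof.
move=> h; apply: ge_sup; first by case: (has_sup_subordinate U).
by move=> _ [f sf <-]; exact: h.
Qed.

Lemma inner_content_ge0 U : 0 <= inner_content U.
Proof.
apply: le_trans (le_inner_content (subordinate0 U)); apply: L0 => //;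
  exact: continuous_cst.
Qed.

Lemma inner_content0 : inner_content set0 = 0.
Proof.
apply/eqP; rewrite eq_le inner_content_ge0 andbT;
  apply: inner_content_le => f [_ f0].
have -> : f = fun=> 0; last by rewrite (functional_cst posL) mul0r.
apply/funext => x; apply/eqP; rewrite eq_le.
by have /andP[-> ] := f0 x; rewrite indicE in_set0 => ->.
Qed.

Lemma inner_contentT : inner_content setT = Lam (fun=> 1).
Proof.
apply/eqP; rewrite eq_le inner_content_le/=; last by move=> f;
  exact: subordinate_le.
apply: le_inner_content; split; first exact: continuous_cst.
by move=> x; rewrite ler01/= indicE in_setT.
Qed.

(** Giving infinite cost to the sets that are not open makes [mu_ext], which
    ranges over all Borel covers, an infimum over open covers. *)
Definition open_cost (A : set (borel T)) : \bar R :=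
  if pselect (open (A : set T)) is left _ then (inner_content A)%:E else +oo%E.

Lemma open_costE U : open U -> open_cost U = (inner_content U)%:E.
Proof. by rewrite /open_cost; case: pselect. Qed.

Lemma open_cost0 : open_cost set0 = 0%E.
Proof. by rewrite open_costE ?inner_content0//; exact: open0. Qed.

Lemma open_cost_ge0 A : (0 <= open_cost A)%E.
Proof. by rewrite /open_cost; case: pselect => // _;
  rewrite lee_fin inner_content_ge0. Qed.

Definition riesz_outer : set (borel T) -> \bar R := mu_ext open_cost.

Local Notation mu := riesz_outer.

HB.instance Definition _ := isOuterMeasure.Build R (borel T) mu
  (mu_ext0 open_cost0 open_cost_ge0) (mu_ext_ge0 open_cost_ge0)
  (@le_mu_ext _ _ _ open_cost)
  (mu_ext_sigma_subadditive open_cost_ge0).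

Lemma outer_le_inner_content U : open U -> (mu U <= (inner_content U)%:E)%E.
Proof.
move=> oU; rewrite -open_costE//; apply: ereal_inf_lbound => /=.
exists (fun k => if k is 0%N then U else set0).
  split; first by case=> [|k]; [exact: open_borel|exact: measurable0].
  by move=> x Ux; exists 0%N.
rewrite nneseries_recl//; last by move=> k _; exact: open_cost_ge0.
rewrite eseries_cond eseries0 ?adde0// => -[|k]//= _ _.
exact: open_cost0.
Qed.

(** Dini's argument: the functions [g n + c] increase in [n] and exceed [f] at
    each point from some [n] on, hence everywhere for some [n] by
    compactness. *)
Lemma functional_le_cover U f (F : nat -> set T) e : 0 < e ->
  (forall k, open (F k)) -> U `<=` \bigcup_k F k -> subordinate U f ->
  exists n, Lam f <= \sum_(k < n) inner_content (F k) + e.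
Proof.
move=> e0 oF UF sf; case: (sf) => cf fU.
pose g n x : R := \sum_(k < n) inf_convolution n \1_(F k) x.
have cg n : continuous (g n).
  by apply: (@continuous_sum (fun k => inf_convolution n \1_(F k))) => k;
    exact: bump_continuous.
(* The denominator exceeds [Lam 1] and does not vanish. *)
pose c := e / (Lam (fun=> 1) + 1).
have c0 : 0 < c by rewrite divr_gt0// ltr_wpDl.
have ndg x m n : (m <= n)%N -> g m x <= g n x.
  move=> mn; rewrite /g.
  rewrite -!(big_mkord xpredT (fun k => inf_convolution _ \1_(F k) x)).
  rewrite (big_cat_nat _ mn)//= -[leLHS]addr0 lerD//.
    apply: ler_sum => k _; apply: inf_convolution_mono mn;
      exact: norm_indic_le1.
  by apply: sumr_ge0 => k _; have /andP[] := bump_bound (F k) n x.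
pose O n := [set x | f x < g n x + c].
have [|m n mn x|x|n On] := @increasing_cover _ _ cT O.
- move=> n; apply: open_lt => //; apply: continuous_add => //;
  exact: continuous_cst.
- by rewrite /O/= => /lt_le_trans; apply; rewrite lerD2r ndg.
- case: (pselect (U x)) => [/UF[k _ Fkx]|nUx].
    have [n0 hn0] := bump_eq1 (oF k) Fkx.
    pose n := maxn n0 k.+1; exists n; rewrite /O/=.
    have kn : (k < n)%N by rewrite leq_max ltnSn orbT.
    have g1 : 1 <= g n x.
      rewrite /g (bigD1 (Ordinal kn))//= hn0 ?leq_maxl// lerDl.
      by apply: sumr_ge0 => i _; have /andP[] := bump_bound (F i) n x.
    by apply: le_lt_trans (subordinate_le1 x sf) _; apply: le_lt_trans g1 _;
      rewrite ltrDl.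
  exists 0%N; rewrite /O/= /g big_ord0 add0r; apply: le_lt_trans c0.
  by have /andP[_] := fU x; rewrite indicE memNset.
have cc : continuous (fun _ : T => c) by exact: continuous_cst.
exists n; apply: (@le_trans _ _ (Lam (fun x => g n x + c))).
  by apply: functional_le => //; [exact: continuous_add|move=> x; exact/ltW/On].
rewrite LD// (functional_cst posL).
rewrite (@functional_sum _ posL (fun k => inf_convolution n \1_(F k)));
  last first.
  by move=> k; exact: bump_continuous.
apply: lerD.
  apply: ler_sum => k _; apply: le_inner_content; split;
    first exact: bump_continuous.
  by move=> x; exact: bump_bound.
by rewrite /c mulrAC ler_pdivrMr ?ltr_wpDl// ler_wpM2l ?lerDl// ltW.
Qed.

Lemma inner_content_le_outer U : open U -> ((inner_content U)%:E <= mu U)%E.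
Proof.
move=> oU; apply: le_ereal_inf_tmp => _ [F [mF UF] <-].
have [oF|/existsNP[k noF]] :=
  pselect (forall k, open (F k : set T)); last first.
  rewrite (@eseries_pinfty _ _ xpredT k)// ?leey//.
  - by move=> n _; rewrite gt_eqF// (lt_le_trans _ (open_cost_ge0 _)).
  - by rewrite /open_cost; case: pselect.
have S0 : (0 <= \sum_(k <oo) open_cost (F k))%E.
  by apply: nneseries_ge0 => k _ _; exact: open_cost_ge0.
have Sn n : ((\sum_(k < n) inner_content (F k))%:E <=
  \sum_(k <oo) open_cost (F k))%E.
  have := @nneseries_lim_ge _ (open_cost \o F) xpredT 0 n (fun _ _ _ =>
    open_cost_ge0 _).
  rewrite big_mkord -sumEFin; apply: le_trans; apply: lee_sum => k _ /=.
  by rewrite open_costE.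
case: (\sum_(k <oo) _)%E S0 Sn => [r| |] _ Sn; [|by rewrite leey|].
  rewrite lee_fin; apply: inner_content_le => f sf; apply/ler_addgt0Pr => e e0.
  have [n hn] := functional_le_cover e0 oF UF sf; apply: le_trans hn _.
  by rewrite lerD2r -lee_fin.
by have := Sn 0%N.
Qed.

Lemma riesz_outerE U : open U -> mu U = (inner_content U)%:E.
Proof.
by move=> oU; apply/eqP; rewrite eq_le outer_le_inner_content//
  inner_content_le_outer.
Qed.

(** Caratheodory's criterion for [U], tested on an open set [V].  If [f] nearly
    attains the content of [V `&` U], so does the positive part [h] of [f - c];
    but [h] vanishes on the open set [W] of the points of [V] with [f < c],
    which contains [V `\` U].  Adding to [h] a function subordinate to [W]
    gives a function subordinate to [V]. *)
Lemma inner_content_split U V : open U -> open V -> forall e, 0 < e ->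
  exists2 W, open W /\ V `\` U `<=` W &
    inner_content (V `&` U) + inner_content W <= inner_content V + e.
Proof.
move=> oU oV e e0.
have e20 : 0 < e / 2 by rewrite divr_gt0.
have [_ [f sf <-] fe] := sup_adherent e20 (has_sup_subordinate (V `&` U)).
case: (sf) => cf fVU.
pose c := e / 2 / (Lam (fun=> 1) + 1).
have c0 : 0 < c by rewrite divr_gt0// ltr_wpDl.
pose h x : R := Num.max (f x - c) 0.
have cfc : continuous (fun x => f x - c) by apply: continuous_sub => //;
  exact: continuous_cst.
have ch : continuous h.
  move=> x; apply: (@continuous_max R T (fun x => f x - c) (fun=> 0)).
    exact: cfc.
  exact: cst_continuous.
pose W := V `&` [set x | f x < c]; exists W.
  split; first by apply: openI => //; apply: open_lt => //;
    exact: continuous_cst.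
  move=> x [Vx nUx]; split=> //=; apply: le_lt_trans c0.
  by have /andP[_] := fVU x; rewrite indicE memNset// => -[].
have hL : Lam f <= Lam h + e / 2.
  apply: (@le_trans _ _ (Lam (fun x => h x + c))).
    apply: functional_le => //; first by apply: continuous_add => //;
      exact: continuous_cst.
    by move=> x; rewrite -lerBlDr /h le_max lexx.
  rewrite LD//; last exact: continuous_cst.
  rewrite (functional_cst posL) lerD2l /c mulrAC ler_pdivrMr ?ltr_wpDl//.
  by rewrite ler_wpM2l ?lerDl// ltW.
suff : inner_content W <= inner_content V - Lam h by move: fe hL;
  rewrite /inner_content; lra.
apply: inner_content_le => g [cg gW]; rewrite lerBrDl -LD//;
  apply: le_inner_content.
split; first exact: continuous_add.
move=> x; have /andP[g0 gx] := gW x; have /andP[f0 fx] := fVU x.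
have h0 : 0 <= h x by rewrite /h le_max lexx orbT.
rewrite addr_ge0//=; case: (ltP (f x) c) => fc.
  have -> : h x = 0 by apply/max_idPr; rewrite subr_le0 ltW.
  rewrite add0r (le_trans gx)// !indicE;
    case: (boolP (x \in W)) => // /set_mem[Vx _].
  by rewrite mem_set.
have -> : g x = 0.
  apply/eqP; rewrite eq_le g0 andbT (le_trans gx)// indicE memNset// => -[_ /=].
  by rewrite ltNge fc.
rewrite addr0; have hf : h x <= f x by rewrite /h ge_max f0 lerBlDr lerDl ltW.
rewrite (le_trans hf)// (le_trans fx)// !indicE.
case: (boolP (x \in V `&` U)) => // /set_mem[Vx _]; by rewrite mem_set.
Qed.

Lemma open_caratheodory U : open U -> mu.-caratheodory U.
Proof.
move=> oU; apply: le_caratheodory_measurable => X.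
have VU V : (mu (V `&` U) + mu (V `&` ~` U) <= open_cost V)%E.
  rewrite /open_cost; case: pselect => [oV|_]; last by rewrite leey.
  apply/lee_addgt0Pr => e e0.
  have [W [oW VUW] hW] := inner_content_split oU oV e0.
  apply: (@le_trans _ _ ((inner_content (V `&` U))%:E +
    (inner_content W)%:E)%E); last first.
    by rewrite -EFinD lee_fin.
  apply: leeD; first by rewrite outer_le_inner_content//; exact: openI.
  apply: le_trans (outer_le_inner_content oW); exact: le_outer_measure.
apply: le_ereal_inf_tmp => _ [F [mF XF] <-].
apply: (@le_trans _ _ (\sum_(k <oo) (mu (F k `&` U) + mu (F k `&` ~` U)))%E).
  rewrite nneseriesD; try by move=> *; exact: outer_measure_ge0.
  by apply: leeD; (apply: le_trans;
    last exact: outer_measure_sigma_subadditive);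
    apply: le_outer_measure; rewrite -setI_bigcupl; exact: setSI.
apply: lee_nneseries => k *; last exact: VU.
by rewrite adde_ge0// outer_measure_ge0.
Qed.

Lemma borel_caratheodory (A : set (borel T)) : measurable A ->
  mu.-caratheodory A.
Proof.
move: A; apply: smallest_sub.
  exact: (@sigma_algebra_measurable _ (caratheodory_type mu)).
by move=> U; exact: open_caratheodory.
Qed.

Lemma riesz_outer_sigma_additive :
  semi_sigma_additive (riesz_outer : set (borel T) -> \bar R).
Proof.
move=> F mF tF mUF.
have := @caratheodory_measure_sigma_additive _ (borel T) riesz_outer.
by apply=> //; [move=> n|]; exact: borel_caratheodory.
Qed.

Lemma sum_clip (t : R) n : 0 <= t ->
  \sum_(i < n) Num.min 1 (Num.max 0 (t - i%:R)) = Num.min t n%:R.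
Proof.
move=> t0; elim: n => [|n IH].
  by rewrite big_ord0; apply/esym/min_idPr.
rewrite big_ord_recr/= IH -natr1.
have n0 : 0 <= n%:R :> R by [].
case: (lerP t n%:R) => h1.
  have -> : Num.max 0 (t - n%:R) = 0 by apply/max_idPl; lra.
  have -> : Num.min 1 0 = 0 :> R by apply/min_idPr; lra.
  by have -> : Num.min t (n%:R + 1) = t; [apply/min_idPl; lra|rewrite addr0].
have -> : Num.max 0 (t - n%:R) = t - n%:R by apply/max_idPr; lra.
case: (lerP 1 (t - n%:R)) => h2.
  by have -> : Num.min t (n%:R + 1) = n%:R + 1 by apply/min_idPr; lra.
have -> : Num.min t (n%:R + 1) = t by apply/min_idPl; lra.
by ring.
Qed.

Section Representation.
Variable M : {measure set (borel T) -> \bar R}.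
Hypothesis ME : forall U, open U -> M U = (inner_content U)%:E.

Let Moo : (M setT < +oo)%E.
Proof. by rewrite ME ?ltry//; exact: openT. Qed.

(** With [N = n.+1] slices of [N * f], the slice [s i] lies between the indicators of
    [U i.+1] and of [U i].  Bounding [Lam] of the slices by the latter and the
    integrals of the slices by the former shifts the index by one, which costs
    [Lam 1] in total, hence [Lam 1 / N] after division by [N]. *)
Lemma functional_le_pairing f : continuous f -> (forall x, 0 <= f x <= 1) ->
  Lam f <= pairing f M.
Proof.
move=> cf f01; apply/ler_addgt0Pr => e e0.
have [n ne] : exists n : nat, Lam (fun=> 1) <= n.+1%:R * e.
  exists (Num.truncn (Lam (fun=> 1) / e)); rewrite -ler_pdivrMr//.
  by apply/ltW; exact: truncnS_gt.
pose s i x : R := Num.min 1 (Num.max 0 (n.+1%:R * f x - i%:R)).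
pose U i := [set x | i%:R < n.+1%:R * f x].
have cnf : continuous (fun x => n.+1%:R * f x) by exact: continuous_scale.
have cs i : continuous (s i).
  move=> x; apply: (@continuous_min R T (fun=> 1) (fun x =>
    Num.max 0 (n.+1%:R * f x - i%:R))).
    exact: cst_continuous.
  apply: (@continuous_max R T (fun=> 0) (fun x => n.+1%:R * f x - i%:R)).
    exact: cst_continuous.
  by apply: continuous_sub => //; exact: continuous_cst.
have oU i : open (U i) by apply: open_lt => //; exact: continuous_cst.
have sE x : \sum_(i < n.+1) s i x = n.+1%:R * f x.
  have /andP[f0 f1] := f01 x.
  rewrite sum_clip ?mulr_ge0//; apply/min_idPl.
  by rewrite -[leRHS]mulr1 ler_wpM2l.
have s0 i x : 0 <= s i x by rewrite /s le_min ler01 le_max lexx.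
have sU i : subordinate (U i) (s i).
  split=> // x; rewrite s0/= indicE.
  case: (boolP (x \in U i)) => [_|/negP nU]; first by rewrite /s ge_min lexx.
  rewrite /s ge_min; apply/orP; right; rewrite ge_max lexx/= subr_le0 leNgt.
  by apply/negP => h; apply: nU; rewrite inE.
have Us i x : \1_(U i.+1) x <= s i x.
  rewrite indicE; case: (boolP (x \in U i.+1)) => [|_]; last exact: s0.
  rewrite inE /U/= -natr1 => h.
  by rewrite /s le_min lexx/= le_max; apply/orP; right; lra.
have nL : n.+1%:R * Lam f = \sum_(i < n.+1) Lam (s i).
  rewrite -(functional_sum posL)// -(let: And3 _ LZ _ := posL in LZ)//.
  by congr Lam; apply/funext => x; rewrite sE.
have nP : n.+1%:R * pairing f M = \sum_(i < n.+1) pairing (s i) M.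
  have posM := pairing_positive Moo.
  rewrite -(functional_sum posM)// -pairingZ//.
  by congr pairing; apply/funext => x; rewrite sE.
have n0 : 0 < n.+1%:R :> R by [].
rewrite -(ler_pM2l n0) mulrDr nL nP.
apply: (@le_trans _ _ (\sum_(i < n.+1) inner_content (U i))).
  by apply: ler_sum => i _; exact: le_inner_content.
rewrite big_ord_recl addrC; apply: lerD; last first.
  apply: le_trans ne; apply: inner_content_le => f'; exact: subordinate_le.
rewrite [leRHS]big_ord_recr/= -[leLHS]addr0 lerD ?pairing_ge0//.
apply: ler_sum => i _; rewrite /bump/= add1n.
have -> : inner_content (U i.+1) = fine (M (U i.+1)) by rewrite ME.
by apply: measure_le_pairing => //; exact: open_borel.
Qed.

(** The inequality for [f] and for [1 - f] gives equality when [f] takes its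
    values in the unit interval; affine rescaling gives the rest. *)
Lemma pairing_eq_functional f : continuous f -> pairing f M = Lam f.
Proof.
have posM := pairing_positive Moo.
have c1 := @continuous_cst 1.
have P1 : pairing (fun=> 1) M = Lam (fun=> 1).
  by rewrite pairing_cst mul1r// ME ?inner_contentT//; exact: openT.
have h01 g : continuous g -> (forall x, 0 <= g x <= 1) -> pairing g M = Lam g.
  move=> cg g01; apply/eqP; rewrite eq_le functional_le_pairing// andbT.
  rewrite -(lerD2l (- Lam (fun=> 1))) -{1}P1.
  rewrite -lerN2 !opprD !opprK.
  rewrite -(functionalB posM)// -(functionalB posL)//.
  apply: functional_le_pairing; first exact: continuous_sub.
  by move=> x; have /andP[? ?] := g01 x; apply/andP; split; lra.
move=> cf; pose s := supnorm f + 1.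
have s0 : 0 < s by rewrite ltr_wpDl// supnorm_ge0.
have -> : f = fun x => (2 * s) * ((2 * s)^-1 * (f x + s)) - s.
  by apply/funext => x; field; rewrite gt_eqF.
have cfs : continuous (fun x => (2 * s)^-1 * (f x + s)).
  by apply: continuous_scale; apply: continuous_add => //;
    exact: continuous_cst.
have c2 := @continuous_scale (2 * s) _ cfs.
have cs := @continuous_cst s.
rewrite (functionalB posM)// (functionalB posL)//.
rewrite (functional_cst posM) (functional_cst posL) P1; congr (_ - _).
rewrite (let: And3 _ LZ _ := posM in LZ)// (let: And3 _ LZ _ := posL in LZ)//.
congr (_ * _); apply: h01 => // x.
have := le_supnorm cT x cf; rewrite ler_norml => /andP[fl fr].
rewrite mulr_ge0 ?invr_ge0 ?mulr_ge0//=; try (rewrite /s; lra).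
rewrite mulrC ler_pdivrMr ?mulr_gt0// /s; lra.
Qed.

End Representation.

(** The representing measure is the restriction of [riesz_outer] to the Borel
    sets; restricting it further to the whole space with [mfrestr] records that
    it is finite. *)
Theorem riesz_representation :
  exists M : {finite_measure set (borel T) -> \bar R},
    forall f, continuous f -> pairing f M = Lam f.
Proof.
have [M ME] : exists M : {measure set (borel T) -> \bar R},
    forall U, open U -> M U = (inner_content U)%:E.
  pose M : {measure set (borel T) -> \bar R} :=
    HB.pack riesz_outer (isMeasure.Build _ (borel T) R riesz_outer
      (outer_measure0 riesz_outer) (outer_measure_ge0 riesz_outer)
        riesz_outer_sigma_additive).
  by exists M => U oU; exact: riesz_outerE.
have Moo : (M setT < +oo)%E by rewrite ME ?ltry//; exact: openT.
exists (mfrestr measurableT Moo : {finite_measure set (borel T) -> \bar R}).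
move=> f cf; apply: pairing_eq_functional => // U oU.
by rewrite /= /mfrestr /mrestr setIT ME.
Qed.

End Content.
Lemma riesz_probability (Lam : (T -> R) -> R) : positive_functional Lam ->
  Lam (fun=> 1) = 1 ->
  exists P : probability (borel T) R, forall f, continuous f ->
    pairing f P = Lam f.
Proof.
move=> posL L1; have [M ML] := riesz_representation posL.
have Moo := finite_measure_lty M.
have M1 : M setT = 1%E.
  rewrite -[LHS]fineK ?ge0_fin_numE// -pairing1//; congr EFin.
  by rewrite ML ?L1//; exact: continuous_cst.
exists (mnormalize M point) => f cf; rewrite -ML//; apply: eq_pairing => A mA.
exact: mnormalizeE M1.
Qed.

End Riesz.

(** The Riesz theorem provides the measure that [dual] selects. *)
Lemma dualP {R : realType} {S T : pointedMetricType R} (L : (S -> R) -> T -> R)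
  (m : {finite_measure set (borel T) -> \bar R}) : compact [set: S] ->
  positive_functional (fun f => pairing (L f) m) -> is_dual L m (dual L m).
Proof.
move=> cS posL; rewrite /dual; case: pselect => [e|[]];
  first exact: projT2 (cid e).
by have [M ML] := riesz_representation cS posL; exists M => f /ML.
Qed.

(** * The transfer operator of a single expanding map *)

(** The cone [cone delta beta Q] together with the zero function: subtracting
    a multiple of one cone function from another may leave nothing. *)
Definition qcone {R : realType} {T : pointedMetricType R} (delta beta Q : R) :
    set (T -> R) :=
  [set f : T -> R | [/\ continuous f, forall x, 0 <= f x &
    forall x x', mdist x x' <= delta ->
      f x <= expR (Q * mdist x x' `^ beta) * f x']].

Section Transfer.
Context {R : realType} {S T : pointedMetricType R}.
Variables (F : S -> T) (phi : S -> R) (D : nat) (delta rho H beta V : R).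
Hypothesis cS : compact [set: S].
Hypothesis delta0 : 0 < delta.
Hypothesis rho01 : 0 < rho < 1.
Hypothesis H0 : 0 < H.
Hypothesis beta01 : 0 < beta < 1.
Hypothesis fibre : forall z, (`I_1 #<= F @^-1` [set z])%card /\
  (F @^-1` [set z] #<= `I_D)%card.
Hypothesis expanding : forall x x', mdist x x' <= delta ->
  mdist x x' <= rho * mdist (F x) (F x').
Hypothesis covering : forall x, cball (F x) delta `<=` F @` cball x delta.
Hypothesis phi_cont : continuous phi.
Hypothesis phi_holder : forall x x', mdist x x' <= delta ->
  `|phi x - phi x'| <= H * mdist x x' `^ beta.
Hypothesis phi_bounded : forall x, `|phi x| <= V.
Implicit Types (f g : S -> R) (z : T) (y : S).

Local Notation L := (transfer F phi).
Local Notation fib z := (fset_set (F @^-1` [set z])).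

Lemma fibre_finite z : finite_set (F @^-1` [set z]).
Proof. by have [_ /card_le_finite] := fibre z; apply. Qed.

Lemma in_fib z y : (y \in fib z) = (F y == z).
Proof.
rewrite in_fset_set; last exact: fibre_finite.
by apply/idP/eqP; rewrite inE.
Qed.

Lemma fib_neq0 z : exists y, F y = z.
Proof.
have [+ _] := fibre z.
have [->|/set0P[y Fy] _] := eqVneq (F @^-1` [set z]) set0; last by exists y.
rewrite card_le0 => /eqP I0; have : [set: nat] 0%N by [].
by have : `I_1 0%N by []; rewrite I0.
Qed.

Lemma transferE f z : L f z = \sum_(y <- fib z) expR (phi y) * f y.
Proof. by rewrite /transfer fsbig_finite//; exact: fibre_finite. Qed.

Lemma size_fib z : (#|` fib z| <= D)%N.
Proof.
have /finite_setP[n Fn] := fibre_finite z; rewrite (card_fset_set Fn).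
have [_ FD] := fibre z.
by rewrite -card_le_II -(card_le_eql Fn).
Qed.

Lemma degree_gt0 : (0 < D)%N.
Proof.
have [y Fy] := fib_neq0 point; apply: leq_trans (size_fib point).
by rewrite cardfs_gt0; apply/fset0Pn; exists y; rewrite in_fib Fy.
Qed.

Lemma sum_fib_le (G : S -> R) c z : 0 <= c -> (forall y, F y = z -> G y <= c) ->
  \sum_(y <- fib z) G y <= D%:R * c.
Proof.
move=> c0 Gc; apply: (@le_trans _ _ (\sum_(y <- fib z) c)).
  by rewrite big_seq [leRHS]big_seq; apply: ler_sum => y;
    rewrite in_fib => /eqP/Gc.
rewrite big_const_seq count_predT iter_addr_0 -[leLHS]mulr_natl.
by rewrite ler_wpM2r// ler_nat size_fib.
Qed.

Lemma le_transfer f g : (forall x, f x <= g x) -> forall z, L f z <= L g z.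
Proof.
move=> fg z; rewrite !transferE; apply: ler_sum => y _.
by rewrite ler_wpM2l ?expR_ge0.
Qed.

Lemma transferD f g z : L (fun x => f x + g x) z = L f z + L g z.
Proof.
by rewrite !transferE -big_split/=; apply: eq_bigr => y _; rewrite mulrDr.
Qed.

Lemma transferZ c f z : L (fun x => c * f x) z = c * L f z.
Proof.
by rewrite !transferE big_distrr/=; apply: eq_bigr => y _; rewrite mulrCA.
Qed.

Lemma transfer_ge0 f : (forall x, 0 <= f x) -> forall z, 0 <= L f z.
Proof.
by move=> f0 z; rewrite transferE; apply: sumr_ge0 => y _;
  rewrite mulr_ge0 ?expR_ge0.
Qed.

Lemma transfer_ge_term f y z : (forall x, 0 <= f x) -> F y = z ->
  expR (phi y) * f y <= L f z.
Proof.
move=> f0 Fy; rewrite transferE (big_fsetD1 y) ?in_fib ?Fy//= lerDl.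
by apply: sumr_ge0 => u _; rewrite mulr_ge0 ?expR_ge0.
Qed.

Lemma transfer_ge f y : (forall x, 0 <= f x) -> expR (- V) * f y <= L f (F y).
Proof.
move=> f0; apply: le_trans (transfer_ge_term f0 (erefl (F y))).
rewrite ler_wpM2r// ler_expR.
by have := phi_bounded y; rewrite ler_norml => /andP[].
Qed.

Lemma transfer_gt0 f : (forall x, 0 < f x) -> forall z, 0 < L f z.
Proof.
move=> f0 z; have [y <-] := fib_neq0 z.
apply: lt_le_trans (transfer_ge y (fun x => ltW (f0 x))).
by rewrite mulr_gt0 ?expR_gt0.
Qed.

Lemma transfer_le f c : 0 <= c -> (forall x, f x <= c) ->
  forall z, L f z <= D%:R * expR V * c.
Proof.
move=> c0 fc z; rewrite transferE -mulrA; apply: sum_fib_le.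
  by rewrite mulr_ge0 ?expR_ge0.
move=> y _; apply: (@le_trans _ _ (expR (phi y) * c)).
  by rewrite ler_wpM2l ?expR_ge0.
rewrite ler_wpM2r// ler_expR.
by have := phi_bounded y; rewrite ler_norml => /andP[].
Qed.

(** The covering condition provides a preimage of [z'] within [delta] of each
    preimage of [z]; expansion then brings it closer. *)
Lemma lift_fibre z z' : mdist z z' <= delta -> exists h : S -> S,
  forall y, F y = z -> F (h y) = z' /\ mdist y (h y) <= rho * mdist z z'.
Proof.
move=> zz'.
have [h hP] : {h : S -> S & forall y, F y = z ->
    F (h y) = z' /\ mdist y (h y) <= rho * mdist z z'}.
  apply: (@choice _ _ (fun y y' => F y = z ->
    F y' = z' /\ mdist y y' <= rho * mdist z z')) => y.
  have [Fy|nFy] := pselect (F y = z); last by exists y.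
  have [y' yy' Fy'] : (F @` cball y delta) z' by apply: covering;
    rewrite /cball/= Fy.
  exists y' => _; split=> //; rewrite -Fy -Fy'; exact: expanding.
by exists h.
Qed.

Let rho0 : 0 < rho. Proof. by case/andP: rho01. Qed.
Let rho_le1 : rho <= 1. Proof. by case/andP: rho01 => _ /ltW. Qed.
Let beta0 : 0 < beta. Proof. by case/andP: beta01. Qed.

Lemma le_delta_lift z z' y y' : mdist z z' <= delta ->
  mdist y y' <= rho * mdist z z' -> mdist y y' <= delta.
Proof.
move=> zz' /le_trans; apply; apply: le_trans zz'.
by rewrite ler_piMl ?mdist_ge0.
Qed.

(** Two points of a fibre at distance at most [delta] coincide, by expansion.
    Lifts from [z] to [z'] and back move points by at most [rho * delta / 2],
    so they are inverse to each other.  For points [z] and [z'] at distance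
    [delta] this can fail when [rho > 1 / 2], and the two fibres may even have
    different cardinals. *)
Lemma close_fibres z z' : mdist z z' <= delta / 2 -> exists2 h : S -> S,
  (forall y, F y = z -> mdist y (h y) <= rho * mdist z z') &
  forall G : S -> R, \sum_(y <- fib z') G y = \sum_(y <- fib z) G (h y).
Proof.
move=> zz'2; have zz' : mdist z z' <= delta.
  by apply: le_trans zz'2 _; rewrite ler_pdivrMr// ler_peMr ?ler1n ?ltW.
have z'z : mdist z' z <= delta by rewrite metric_sym.
have [h hP] := lift_fibre zz'; have [k kP] := lift_fibre z'z.
have rzz' : rho * mdist z z' <= delta / 2.
  by apply: le_trans zz'2; rewrite ler_piMl ?mdist_ge0.
have near_inj x y y' : mdist x y <= rho * mdist z z' ->
    mdist x y' <= rho * mdist z z' -> F y = F y' -> y = y'.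
  move=> xy xy' Fyy'; apply: mdist_positivity.
  apply/eqP; rewrite eq_le mdist_ge0 andbT.
  have yy' : mdist y y' <= delta.
    apply: le_trans (metric_triangle y x y') _; rewrite [delta]splitr.
    by rewrite lerD ?(metric_sym y x)//; exact: le_trans rzz'.
  by have := expanding yy'; rewrite Fyy' mdistxx mulr0.
exists h => [y /hP[]//|G].
rewrite -!(fsbig_finite _ _ (fibre_finite _)).
apply: reindex_fsbig; split.
- by move=> y /hP[].
- move=> y y' /[!inE] Fy Fy' hyy'.
  have [Fhy dhy] := hP _ Fy; have [Fhy' dhy'] := hP _ Fy'.
  apply: (near_inj (h y)); [by rewrite metric_sym|by rewrite metric_sym hyy'|].
  by rewrite Fy Fy'.
- move=> y' Fy'; have [Fky dky] := kP _ Fy'; exists (k y') => //.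
  have [Fhk dhk] := hP _ Fky.
  apply: (near_inj (k y')) => //; last by rewrite Fhk Fy'.
  by rewrite metric_sym (metric_sym z z').
Qed.

Lemma transfer_continuous f : continuous f -> continuous (L f).
Proof.
move=> cf; apply/continuous_mdistP => z e e0.
have cg : continuous (fun y => expR (phi y) * f y).
  move=> y; apply: (@continuousM R S (fun y => expR (phi y)) f); last exact: cf.
  apply: continuous_comp; [exact: phi_cont|exact: continuous_expR].
pose c := e / (D%:R + 1); have c0 : 0 < c by rewrite divr_gt0// ltr_wpDl.
have [d d0 dg] := uniform_continuous_mdist cS cg c0.
exists (Num.min d (delta / 2)) => [|z']; first by rewrite lt_min d0 divr_gt0.
rewrite lt_min => /andP[zd /ltW zz'].
have [h hP hE] := close_fibres zz'.
rewrite !transferE hE -sumrB; apply: le_lt_trans (ler_norm_sum _ _ _) _.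
apply: (@le_lt_trans _ _ (D%:R * c)); last first.
  by rewrite /c mulrCA gtr_pMr// ltr_pdivrMr ?ltr_wpDl// mul1r ltrDl.
apply: sum_fib_le => [|y Fy]; first exact: ltW.
apply/ltW/dg; apply: le_lt_trans (hP y Fy) _; apply: le_lt_trans zd.
by rewrite ler_piMl ?mdist_ge0.
Qed.

Lemma term_lift Q f z z' y y' : 0 <= Q -> qcone delta beta Q f ->
  mdist z z' <= delta -> mdist y y' <= rho * mdist z z' ->
  expR (phi y) * f y <=
  expR (rho `^ beta * (Q + H) * mdist z z' `^ beta) * (expR (phi y') * f y').
Proof.
move=> Q0 [_ f0 fQ] zz' yy'; have yd := le_delta_lift zz' yy'.
have pw : mdist y y' `^ beta <= rho `^ beta * mdist z z' `^ beta.
  rewrite -powRM ?mdist_ge0 ?(ltW rho0)//; apply: ge0_ler_powR => //.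
  - exact: ltW.
  - by rewrite nnegrE mdist_ge0.
  - by rewrite nnegrE mulr_ge0 ?mdist_ge0// ltW.
apply: (@le_trans _ _ (expR (phi y) * (expR (Q * mdist y y' `^ beta) * f y'))).
  by rewrite ler_wpM2l ?expR_ge0 ?fQ.
rewrite !mulrA -!expRD ler_wpM2r// ler_expR.
have := phi_holder yd; rewrite ler_norml => /andP[_ hp].
have : (Q + H) * mdist y y' `^ beta <=
  (Q + H) * (rho `^ beta * mdist z z' `^ beta).
  by rewrite ler_wpM2l// addr_ge0// ltW.
rewrite mulrA [X in _ <= X * _]mulrC; lra.
Qed.

(** The first term is the regularity [Q] improved by expansion, with the
    contribution of [phi].  The second one pays for the factor [D] lost at
    distances between [delta / 2] and [delta], where fibres are not matched. *)
Definition image_regularity Q : R :=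
  rho `^ beta * (Q + H) + ln D%:R / (delta / 2) `^ beta.

(** At distances at most [delta / 2] the fibres correspond to each other and the
    sums are compared term by term.  Beyond, each term over [z] is compared with
    the whole sum over [z'], which costs a factor [D]. *)
Lemma transfer_qcone Q f : 0 <= Q -> qcone delta beta Q f ->
  qcone delta beta (image_regularity Q) (L f).
Proof.
move=> Q0 qf; case: (qf) => cf f0 fQ; split.
- exact: transfer_continuous.
- exact: transfer_ge0.
move=> z z' zz'; set w := mdist z z' `^ beta.
have d2 : 0 < delta / 2 by rewrite divr_gt0.
have lnD0 : 0 <= ln (D%:R : R) by rewrite ln_ge0// ler1n degree_gt0.
have w0 : 0 <= w by exact: powR_ge0.
rewrite /image_regularity mulrDl expRD; set c := expR (_ * w).
case: (lerP (mdist z z') (delta / 2)) => zz'2.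
  have [h hP hE] := close_fibres zz'2.
  apply: (@le_trans _ _ (c * L f z')).
    rewrite transferE (transferE f z') hE big_distrr/= big_seq [leRHS]big_seq.
    apply: ler_sum => y; rewrite in_fib => /eqP /hP; exact: term_lift.
  rewrite mulrAC ler_peMr ?mulr_ge0 ?expR_ge0 ?transfer_ge0//.
  by rewrite -[leLHS]expR0 ler_expR mulr_ge0// divr_ge0// powR_ge0.
have [h hP] := lift_fibre zz'.
rewrite transferE; apply: (@le_trans _ _ (D%:R * (c * L f z'))).
  apply: sum_fib_le; first by rewrite mulr_ge0 ?expR_ge0 ?transfer_ge0.
  move=> y /hP[Fhy yhy]; apply: le_trans (term_lift Q0 qf zz' yhy) _.
  by rewrite ler_wpM2l ?expR_ge0// transfer_ge_term.
rewrite mulrA ler_wpM2r ?transfer_ge0// mulrC ler_wpM2l ?expR_ge0//.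
rewrite -[leLHS]lnK; last by rewrite posrE ltr0n degree_gt0.
rewrite ler_expR -mulrA ler_peMr// ler_pdivlMl ?powR_gt0// mulr1.
apply: ge0_ler_powR; rewrite ?nnegrE ?mdist_ge0//; exact: ltW.
Qed.

End Transfer.

(** * Exponential contraction of ratios *)

Lemma qcone_mono {R : realType} {T : pointedMetricType R} (delta beta Q Q' : R)
  (f : T -> R) : Q <= Q' -> qcone delta beta Q f -> qcone delta beta Q' f.
Proof.
move=> QQ' [cf f0 fQ]; split=> // x x' xx'; apply: le_trans (fQ x x' xx') _.
by rewrite ler_wpM2r// ler_expR ler_wpM2r ?powR_ge0.
Qed.

(** This is convexity of the exponential: [q * u] is the mean of [- (q * u)] and
    [u] with weights [(1 - q) / (1 + q)] and its complement. *)
Lemma expR_gap {R : realType} (q u : R) : 0 < q < 1 -> 0 <= u ->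
  (1 - q) / (1 + q) * (expR u - expR (- (q * u))) <= expR u - expR (q * u).
Proof.
move=> /andP[q0 q1] u0.
have p0 : 0 < 1 + q by rewrite addr_gt0.
pose t := (1 - q) / (1 + q).
have t0 : 0 <= t by rewrite divr_ge0 ?subr_ge0 ?ltW.
have t1 : t <= 1 by rewrite ler_pdivrMr// mul1r; lra.
have cvx : expR (q * u) <= t * expR (- (q * u)) + (1 - t) * expR u.
  have := convex_expR (Itv01 t0 t1) (- (q * u)) u.
  rewrite !convRE/=; congr (expR _ <= _).
  by rewrite /unstable.onem /t; field; rewrite gt_eqF.
rewrite -/t; lra.
Qed.

(** Regularity [q * Q] is strictly better than [Q], and this leaves room to
    subtract from [f] a fixed fraction of any multiple of [g] below it. *)
Lemma qcone_sub {R : realType} {T : pointedMetricType R} (delta beta Q q c : R)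
  (f g : T -> R) : 0 <= Q -> 0 < q < 1 -> 0 <= c ->
  qcone delta beta (q * Q) f -> qcone delta beta (q * Q) g ->
  (forall x, c * g x <= f x) ->
  qcone delta beta Q (fun x => f x - (1 - q) / (1 + q) * c * g x).
Proof.
move=> Q0 q01 c0 [cf f0 fQ] [cg g0 gQ] gf.
have /andP[q0 q1] := q01.
pose eta := (1 - q) / (1 + q).
have p0 : 0 < 1 + q by rewrite addr_gt0.
have e0 : 0 <= eta by rewrite divr_ge0 ?subr_ge0 ?ltW.
have e1 : eta <= 1 by rewrite ler_pdivrMr// mul1r; lra.
split.
- by apply: continuous_sub => //; exact: continuous_scale.
- move=> x; rewrite subr_ge0; apply: le_trans (gf x).
  by rewrite -mulrA ler_piMl ?mulr_ge0.
move=> x x' xx'; set u := Q * mdist x x' `^ beta.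
have u0 : 0 <= u by rewrite mulr_ge0 ?powR_ge0.
have quE : q * Q * mdist x x' `^ beta = q * u by rewrite mulrA.
have := fQ _ _ xx'; rewrite quE => fxx'.
have xx'' : mdist x' x <= delta by rewrite metric_sym.
have := gQ _ _ xx''; rewrite metric_sym quE => gx'x.
have {}gx'x : expR (- (q * u)) * g x' <= g x.
  by rewrite expRN ler_pdivrMl ?expR_gt0.
have gap := @expR_gap R q u q01 u0; rewrite -/eta in gap *.
have Eu : expR (q * u) <= expR u by rewrite ler_expR ler_piMl// ltW.
have h1 : eta * c * (expR (- (q * u)) * g x') <= eta * c * g x.
  by rewrite ler_wpM2l// mulr_ge0.
have h2 : (expR u - expR (q * u)) * (c * g x') <=
  (expR u - expR (q * u)) * f x'.
  by rewrite ler_wpM2l// subr_ge0.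
have h3 : eta * (expR u - expR (- (q * u))) * (c * g x') <=
    (expR u - expR (q * u)) * (c * g x').
  by rewrite ler_wpM2r// mulr_ge0.
move: h1 h2 h3 fxx'; set E := expR u; set A := expR (q * u).
set B := expR (- _).
move=> h1 h2 h3 fxx'.
have -> : E * (f x' - eta * c * g x') = E * f x' - E * eta * c * g x' by ring.
have h1' : eta * c * (B * g x') = eta * B * (c * g x') by ring.
have h3' : eta * (E - B) * (c * g x') =
  E * eta * c * g x' - eta * B * (c * g x') by ring.
rewrite h1' in h1; rewrite h3' in h3.
have h2' : (E - A) * f x' = E * f x' - A * f x' by ring.
rewrite h2' in h2; lra.
Qed.

Lemma probability_setT_gt0 d (T : measurableType d) (R : realType)
  (P : probability T R) : (0 < P setT)%E.
Proof. by rewrite probability_setT lte01. Qed.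

Lemma scale_ge0 d (T : measurableType d) (R : realType)
  (m m' : {measure set T -> \bar R}) (c : R) :
  (0 < m' setT)%E -> (m' setT < +oo)%E -> m setT = (c%:E * m' setT)%E -> 0 <= c.
Proof.
move=> m'0 m'oo mm'; have : (0 <= m setT)%E by exact: measure_ge0.
rewrite mm' -(@fineK _ (m' setT)) ?ge0_fin_numE//.
by rewrite -EFinM lee_fin pmulr_lge0// fine_gt0// m'0.
Qed.

Section Iterates.
Context {R : realType} {X : nat -> pointedMetricType R}.
Variables (T : forall n, X n -> X n.+1) (phi : forall n, X n -> R).
Variables (D tau : nat) (delta rho H beta V Q q : R).
Hypothesis phi_cont : forall n, continuous (@phi n).
Hypothesis A1 : condA1 T D.
Hypothesis A2 : condA2 T delta rho.
Hypothesis A3 : condA3 T delta tau.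
Hypothesis A4 : condA4 phi delta H beta V.
Hypothesis Q0 : 0 < Q.
Hypothesis q01 : 0 < q < 1.
Hypothesis Qq : image_regularity D delta rho H beta Q <= q * Q.

Local Notation L n k := (iterL T phi n k).
Local Notation L1 n := (opL T phi n).
Local Notation one n := (const1 (X n)).
Local Notation cone := (qcone delta beta).

Let cX n : compact [set: X n]. Proof. by case: A1. Qed.
Let fibre n z : (`I_1 #<= @T n @^-1` [set z])%card /\
  (@T n @^-1` [set z] #<= `I_D)%card.
Proof. by case: A1 => _ _; apply. Qed.
Let delta0 : 0 < delta. Proof. by case: A2. Qed.
Let rho01 : 0 < rho < 1. Proof. by case: A2. Qed.
Let expanding n (x x' : X n) : mdist x x' <= delta ->
  mdist x x' <= rho * mdist (T x) (T x').
Proof. by case: A2 => _ _ h _; exact: h. Qed.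
Let covering n (x : X n) : cball (T x) delta `<=` @T n @` cball x delta.
Proof. by case: A2. Qed.
Let beta01 : 0 < beta < 1. Proof. by case: A4. Qed.
Let H0 : 0 < H. Proof. by case: A4. Qed.
Let phi_holder n (x x' : X n) : mdist x x' <= delta ->
  `|phi x - phi x'| <= H * mdist x x' `^ beta.
Proof. by case: A4 => _ _ _ h _; exact: h. Qed.
Let phi_bounded n (x : X n) : `|phi x| <= V.
Proof.
case: A4 => _ _ _ _ h; apply: le_trans (h n).
by apply: le_supnorm; [exact: cX|exact: phi_cont].
Qed.

Lemma opL_continuous n f : continuous f -> continuous (L1 n f).
Proof.
move=> cf.
exact: (transfer_continuous (@cX n) delta0 rho01 (@fibre n) (@expanding n)
  (@covering n) (@phi_cont n) cf).
Qed.

Lemma opL_qcone n f : cone Q f -> cone (q * Q) (L1 n f).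
Proof.
move=> qf; apply: qcone_mono Qq _.
exact: (transfer_qcone (@cX n) delta0 rho01 H0 beta01 (@fibre n) (@expanding n)
  (@covering n) (@phi_cont n) (@phi_holder n) (ltW Q0) qf).
Qed.

Lemma iterL_continuous n k f : continuous f -> continuous (L n k f).
Proof.
elim: k n f => //= k IH n f cf; apply: IH; exact: opL_continuous.
Qed.

Lemma le_iterL n k f g : (forall x, f x <= g x) ->
  forall z, L n k f z <= L n k g z.
Proof.
elim: k n f g => //= k IH n f g fg; apply: IH; apply: le_transfer => //;
  exact: fibre.
Qed.

Lemma iterLD n k f g z : L n k (fun x => f x + g x) z = L n k f z + L n k g z.
Proof.
elim: k n f g z => //= k IH n f g z; rewrite -IH; congr (L _ _ _ z).
by apply/funext => y; apply: (@transferD _ _ _ _ _ D).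
Qed.

Lemma iterLZ n k c f z : L n k (fun x => c * f x) z = c * L n k f z.
Proof.
elim: k n f z => //= k IH n f z; rewrite -IH; congr (L _ _ _ z).
by apply/funext => y; apply: (@transferZ _ _ _ _ _ D).
Qed.

Lemma iterL_ge0 n k f : (forall x, 0 <= f x) -> forall z, 0 <= L n k f z.
Proof.
elim: k n f => //= k IH n f f0; apply: IH; apply: transfer_ge0 => //;
  exact: fibre.
Qed.

Lemma iterL_gt0 n k f : (forall x, 0 < f x) -> forall z, 0 < L n k f z.
Proof.
elim: k n f => //= k IH n f f0; apply: IH.
by apply: (transfer_gt0 (@fibre n) (@phi_bounded n)).
Qed.

Lemma iterL_le n k f c : 0 <= c -> (forall x, f x <= c) ->
  forall z, L n k f z <= (D%:R * expR V) ^+ k * c.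
Proof.
elim: k n f c => [|k IH] n f c c0 fc z /=; first by rewrite mul1r.
rewrite exprSr -mulrA; apply: IH; first by rewrite !mulr_ge0 ?expR_ge0.
exact: (transfer_le (@fibre n) (@phi_bounded n)).
Qed.

Lemma iterL_ge n k f y : (forall x, 0 <= f x) ->
  expR (- V) ^+ k * f y <= L n k f (iterT T n k y).
Proof.
elim: k n f y => [|k IH] n f y f0 /=; first by rewrite mul1r.
have Lf0 : forall z, 0 <= L1 n f z by apply: transfer_ge0 => //; exact: fibre.
apply: le_trans (IH n.+1 (L1 n f) (@T n y) Lf0).
rewrite exprSr -mulrA ler_wpM2l ?exprn_ge0 ?expR_ge0//.
exact: (transfer_ge (@fibre n) (@phi_bounded n)).
Qed.

Lemma iterL_qcone n k f : cone Q f -> cone Q (L n k f).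
Proof.
elim: k n f => //= k IH n f qf; apply: IH; apply: qcone_mono (opL_qcone qf).
by rewrite ler_piMl ?ltW//; case/andP: q01.
Qed.

Lemma iterL_qcone_strict n k f : (0 < k)%N -> cone Q f ->
  cone (q * Q) (L n k f).
Proof.
elim: k n f => // k IH n f _ qf /=.
have qf' := opL_qcone qf.
case: k IH => [|k] IH //=.
apply: IH => //; apply: qcone_mono qf'.
by rewrite ler_piMl ?ltW//; case/andP: q01.
Qed.

(** The types [X (adv n (a + b))] and [X (adv (adv n a) b)] are equal but not
    convertible when [a] is a variable; a correspondence between their points
    that is uniform in [f] is enough to compose iterates. *)
Lemma iterL_split n a b (z : X (adv n (a + b))) :
  exists z' : X (adv (adv n a) b), forall f,
    L n (a + b) f z = L (adv n a) b (L n a f) z'.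
Proof.
elim: a n z => [|a IH] n z; first by exists z.
by have [z' hz'] := IH n.+1 z; exists z' => f; exact: (hz' (L1 n f)).
Qed.

Let tau0 : (0 < tau)%N. Proof. by case: A3. Qed.
Let V0 : 0 <= V. Proof. by case: A4 => _ _ /ltW. Qed.

Definition harnack_const : R :=
  expR V ^+ tau * (expR (Q * delta `^ beta) * (D%:R * expR V) ^+ tau).

Local Notation K := harnack_const.

(** Every [z] is reached in [tau] steps from some point within [delta] of [p],
    where [f] is comparable to [f p]. *)
Lemma iterL_ge_max n f p : cone Q f -> forall z,
  f p <= expR V ^+ tau * expR (Q * delta `^ beta) * L n tau f z.
Proof.
move=> [cf f0 fQ] z.
have [y py <-] : (iterT T n tau @` cball p delta) z by case: A3 => _ ->.
have fpy : f p <= expR (Q * delta `^ beta) * f y.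
  apply: le_trans (fQ p y py) _;
    rewrite ler_wpM2r// ler_expR ler_wpM2l ?(ltW Q0)//.
  apply: ge0_ler_powR; rewrite ?nnegrE ?mdist_ge0 ?(ltW delta0)//.
  by case/andP: beta01 => /ltW.
apply: le_trans fpy _; rewrite mulrAC mulrC ler_wpM2r ?expR_ge0//.
have := @iterL_ge n tau f y f0.
by rewrite expRN exprVn ler_pdivrMl ?exprn_gt0 ?expR_gt0.
Qed.

(** After [tau] steps the maximum of [g] bounds the image from above and, through
    [iterL_ge_max], from below. *)
Lemma harnack n g : cone Q g -> forall z z', L n tau g z <= K * L n tau g z'.
Proof.
move=> qg z z'; case: (qg) => cg g0 _.
have [p gp] := continuous_attains_max (@cX n) cg.
apply: le_trans (@iterL_le n tau g (g p) (g0 p) gp z) _.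
rewrite /K mulrA -mulrA [leRHS]mulrC -mulrA.
rewrite ler_wpM2l ?exprn_ge0 ?mulr_ge0 ?expR_ge0// mulrC.
exact: iterL_ge_max.
Qed.

Let D1 : 1 <= D%:R :> R.
Proof. by rewrite ler1n; exact: (degree_gt0 (@fibre 0%N)). Qed.

Lemma harnack_const_ge1 : 1 <= K.
Proof.
have V1 : 1 <= expR V by rewrite -[leLHS]expR0 ler_expR.
rewrite /K mulr_ege1 ?exprn_ege1// mulr_ege1 ?exprn_ege1//.
  by rewrite -[leLHS]expR0 ler_expR mulr_ge0 ?(ltW Q0)// powR_ge0.
by rewrite mulr_ege1.
Qed.

(** The factor [K ^- 2] is the proportion of [L^tau g] that is found below
    [L^tau f], and [(1 - q) / (1 + q)] is the part of it that [qcone_sub] allows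
    one to subtract. *)
Definition contraction_gain : R := (1 - q) / (1 + q) / K ^+ 2.

Lemma contraction_gain01 : 0 < contraction_gain < 1.
Proof.
have /andP[q0 q1] := q01.
have p0 : 0 < 1 + q by rewrite addr_gt0.
have K1 := harnack_const_ge1; have K0 : 0 < K by exact: lt_le_trans K1.
have eta0 : 0 < (1 - q) / (1 + q) by rewrite divr_gt0 ?subr_gt0.
have eta1 : (1 - q) / (1 + q) < 1 by rewrite ltr_pdivrMr// mul1r; lra.
rewrite /contraction_gain divr_gt0 ?exprn_gt0//= ltr_pdivrMr ?exprn_gt0// mul1r.
by apply: lt_le_trans eta1 _; exact: exprn_ege1.
Qed.

(** Let [M'] be the maximum of [f / g], attained at [p].  The positivity of
    [iterL_ge_max] spreads the value at [p] over the whole space, so [L^tau f]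
    dominates the multiple [c] of [L^tau g] with [c = M' / K ^+ 2].  Subtracting
    a fixed fraction of it leaves a function of the cone and lowers the bound
    on the ratio by the factor [1 - contraction_gain]. *)
Lemma one_step n f g M : cone Q f -> cone Q g -> (forall x, 0 < g x) ->
  (forall x x', g x <= K * g x') -> (forall x, f x <= M * g x) ->
  exists a, cone Q (fun z => L n tau f z - a * L n tau g z) /\
    forall z, L n tau f z - a * L n tau g z <=
      (1 - contraction_gain) * M * L n tau g z.
Proof.
move=> qf qg g0 gK fM; case: (qf) => cf f0 _; case: (qg) => cg _ _.
have K1 := harnack_const_ge1; have K0 : 0 < K by exact: lt_le_trans K1.
have cfg : continuous (fun x => f x / g x).
  move=> x; apply: (@continuousM R (X n) f (fun x => (g x)^-1));
    first exact: cf.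
  by apply: continuousV; [rewrite gt_eqF|exact: cg].
have [p fgp] := continuous_attains_max (@cX n) cfg.
pose M' := f p / g p.
have fM' x : f x <= M' * g x by rewrite -ler_pdivrMr.
have M'M : M' <= M by rewrite ler_pdivrMr.
have M'0 : 0 <= M' by rewrite divr_ge0// ltW.
have fp : f p = M' * g p by rewrite divfK// gt_eqF.
pose c := M' / K ^+ 2.
have c0 : 0 <= c by apply: divr_ge0 => //; apply: exprn_ge0; exact: ltW.
have cgf z : c * L n tau g z <= L n tau f z.
  have gz := @iterL_le n tau g (K * g p) (mulr_ge0 (ltW K0) (ltW (g0 p)))
    (fun x => gK x p) z.
  have fz := @iterL_ge_max n f p qf z.
  (* One factor [K] comes from [iterL_ge_max], the other one from [gK]. *)
  rewrite /c mulrAC ler_pdivrMr ?exprn_gt0//.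
  apply: le_trans (ler_wpM2l M'0 gz) _.
  have -> : M' * ((D%:R * expR V) ^+ tau * (K * g p)) =
    (D%:R * expR V) ^+ tau * K * f p by rewrite fp; ring.
  apply: le_trans (ler_wpM2l _ fz) _.
    by rewrite mulr_ge0 ?exprn_ge0 ?mulr_ge0 ?expR_ge0 ?(ltW K0).
  rewrite le_eqVlt; apply/orP; left; apply/eqP; rewrite /harnack_const.
  set a := expR V ^+ tau; set b := (_ * expR V) ^+ tau.
  by ring.
have qLf := @iterL_qcone_strict n tau f tau0 qf.
have qLg := @iterL_qcone_strict n tau g tau0 qg.
exists ((1 - q) / (1 + q) * c); split.
  by apply: qcone_sub => //; exact: ltW.
move=> z; have Lg0 := @iterL_gt0 n tau g g0 z.
have LfM : L n tau f z <= M' * L n tau g z.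
  have := @le_iterL n tau f (fun x => M' * g x) fM' z.
  by rewrite iterLZ.
apply: (@le_trans _ _ ((1 - contraction_gain) * M' * L n tau g z)); last first.
  rewrite ler_wpM2r ?(ltW Lg0)// ler_wpM2l// subr_ge0.
  by have /andP[_ /ltW] := contraction_gain01.
have -> : (1 - q) / (1 + q) * c =
  contraction_gain * M' by rewrite /contraction_gain /c; ring.
have -> : (1 - contraction_gain) * M' * L n tau g z =
  M' * L n tau g z - contraction_gain * M' * L n tau g z by ring.
by rewrite lerD2r.
Qed.

(** Iterating [one_step], the subtracted multiples of [g] accumulate into [A],
    and the bound on what remains decays geometrically. *)
Lemma contraction j k n f g M : (j * tau <= k)%N -> 0 <= M ->
  cone Q f -> cone Q g -> (forall x, 0 < g x) ->
  (forall x x', g x <= K * g x') -> (forall x, f x <= M * g x) ->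
  exists A, forall z, A * L n k g z <= L n k f z <=
    (A + (1 - contraction_gain) ^+ j * M) * L n k g z.
Proof.
elim: j k n f g M => [|j IH] k n f g M jk M0 qf qg g0 gK fM.
  exists 0 => z; rewrite mul0r add0r mul1r iterL_ge0/=; last by case: qf.
  by have := @le_iterL n k f _ fM z; rewrite iterLZ.
have [k' kE] : exists k', k = (tau + k')%N.
  by exists (k - tau)%N; rewrite subnKC// (leq_trans _ jk)// mulSn leq_addr.
move: jk; rewrite {}kE mulSn leq_add2l => jk' {k}.
have [a [qf' f'M]] := one_step qf qg g0 gK fM.
have /andP[_ /ltW th1] := contraction_gain01.
have M'0 : 0 <= (1 - contraction_gain) * M by rewrite mulr_ge0// subr_ge0.
have [A hA] := IH k' (adv n tau) _ _ ((1 - contraction_gain) * M) jk' M'0 qf'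
  (iterL_qcone tau qg)
  (@iterL_gt0 n tau g g0) (harnack qg) f'M.
exists (a + A) => z; have [z' hz'] := iterL_split z.
rewrite !hz'; have := hA z'.
set F := fun x => L n tau f x - a * L n tau g x.
have <- : L (adv n tau) k' F z' + a * L (adv n tau) k' (L n tau g) z' =
    L (adv n tau) k' (L n tau f) z'.
  have -> : L n tau f = fun x => F x + a * L n tau g x.
    by apply/funext => x; rewrite subrK.
  by rewrite (@iterLD _ _ F) iterLZ.
rewrite exprSr => /andP[h1 h2]; apply/andP; split; lra.
Qed.

(** * The limit of the ratios as a positive functional *)

Definition ratio_lb n k f a := forall z, a * L n k (one n) z <= L n k f z.
Definition ratio_ub n k f b := forall z, L n k f z <= b * L n k (one n) z.

Arguments ratio_lb n k f a : clear implicits.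
Arguments ratio_ub n k f b : clear implicits.

Lemma iterL1_gt0 n k z : 0 < L n k (one n) z.
Proof. by apply: iterL_gt0 => x; exact: ltr01. Qed.

Lemma ratio_lb_mono n k k' f a : (k <= k')%N -> ratio_lb n k f a ->
  ratio_lb n k' f a.
Proof.
move=> kk' fa z; have k'E : k' = (k + (k' - k))%N by rewrite subnKC.
move: (k' - k)%N k'E z => j -> z {kk' k'}.
have [z' hz'] := iterL_split z; rewrite !hz'.
by have := le_iterL fa z'; rewrite iterLZ.
Qed.

Lemma ratio_ub_mono n k k' f b : (k <= k')%N -> ratio_ub n k f b ->
  ratio_ub n k' f b.
Proof.
move=> kk' fa z; have k'E : k' = (k + (k' - k))%N by rewrite subnKC.
move: (k' - k)%N k'E z => j -> z {kk' k'}.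
have [z' hz'] := iterL_split z; rewrite !hz'.
by have := le_iterL fa z'; rewrite iterLZ.
Qed.

Lemma ratio_lb_le_ub n k k' f a b : ratio_lb n k f a -> ratio_ub n k' f b ->
  a <= b.
Proof.
move=> /(ratio_lb_mono (leq_maxl k k')) la /(ratio_ub_mono (leq_maxr k k')) ub.
have z : X (adv n (maxn k k')) := point.
by have := le_trans (la z) (ub z); rewrite ler_pM2r ?iterL1_gt0.
Qed.

Lemma iterL_shift n k f c z : L n k (fun x => f x + c) z =
  L n k f z + c * L n k (one n) z.
Proof.
have -> : (fun x => f x + c) = fun x => f x + c * one n x.
  by apply/funext => x; rewrite /const1 mulr1.
by rewrite iterLD iterLZ.
Qed.

Lemma qcone1 n : cone Q (one n).
Proof.
split; [exact: continuous_cst|by move=> x; exact: ler01|move=> x x' _].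
by rewrite mulr1 -[leLHS]expR0 ler_expR mulr_ge0 ?powR_ge0// ltW.
Qed.

Lemma ratio_bounds_qcone n k j f : cone Q f -> (j * tau <= k)%N ->
  exists A, ratio_lb n k f A /\
    ratio_ub n k f (A + (1 - contraction_gain) ^+ j * supnorm f).
Proof.
move=> qf jk; case: (qf) => cf f0 _.
have [||||A hA] := @contraction j k n f (one n) (supnorm f) jk _ qf (qcone1 n).
- exact: (supnorm_ge0 (@cX n)).
- by move=> x; exact: ltr01.
- by move=> x x'; rewrite mulr1 harnack_const_ge1.
- move=> x; rewrite mulr1 (le_trans (ler_norm _))//.
  by apply: (le_supnorm (@cX n)).
by exists A; split=> z; have /andP[] := hA z.
Qed.

(** Adding a large constant makes the relative variation of a Lipschitz function
    as small as needed; at distances at most [delta] a Lipschitz bound is also a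
    Hoelder bound. *)
Lemma lipschitz_qcone n (h : X n -> R) l b : 0 <= l ->
  (forall x x', `|h x - h x'| <= l * mdist x x') -> (forall x, b <= h x) ->
  exists c, cone Q (fun x => h x + c).
Proof.
move=> l0 hl hb; pose m := l * delta `^ (1 - beta) / Q.
have /andP[b0 b1] := beta01.
have m0 : 0 <= m by rewrite divr_ge0 ?(ltW Q0)// mulr_ge0 ?powR_ge0.
(* The shifted function is at least [m], and [Q * m] is the Hoelder constant. *)
exists (m - b).
have hm x : m <= h x + (m - b) by have := hb x; lra.
split.
- apply: continuous_add; last exact: continuous_cst.
  exact: lipschitz_continuous hl.
- by move=> x; exact: le_trans (hm x).
move=> x x' xx'; set w := h x' + _.
have hxx' : h x + (m - b) <= w + l * mdist x x'.
  have := hl x x'; rewrite ler_norml => /andP[_]; rewrite /w; lra.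
apply: le_trans hxx' _.
have w0 : 0 <= w by exact: le_trans (hm x').
apply: (@le_trans _ _ ((1 + Q * mdist x x' `^ beta) * w)); last first.
  by rewrite ler_wpM2r// expR_ge1Dx.
rewrite mulrDl mul1r lerD2l.
apply: (@le_trans _ _ (Q * mdist x x' `^ beta * m)); last first.
  by apply: ler_wpM2l (hm x'); rewrite mulr_ge0 ?powR_ge0// ltW.
have -> : Q * mdist x x' `^ beta * m =
    l * (mdist x x' `^ beta * delta `^ (1 - beta)).
  by rewrite /m; field; rewrite gt_eqF.
rewrite ler_wpM2l//.
have [->|d0] := eqVneq (mdist x x') 0; first by rewrite mulr_ge0 ?powR_ge0.
have {1}-> : mdist x x' = mdist x x' `^ beta * mdist x x' `^ (1 - beta).
  by rewrite -powRD ?d0 ?implybT// addrC subrK powRr1 ?mdist_ge0.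
rewrite ler_wpM2l ?powR_ge0//; apply: ge0_ler_powR => //.
- by rewrite subr_ge0 ltW.
- by rewrite nnegrE mdist_ge0.
- by rewrite nnegrE ltW.
Qed.

(** A Lipschitz minorant of [f] within [e / 4] lies in the cone after addition of
    a constant [c], and constants only translate the ratio. *)
Lemma ratio_bounds_continuous n f e : continuous f -> 0 < e ->
  exists k A, ratio_lb n k f A /\ ratio_ub n k f (A + e).
Proof.
move=> cf e0; have e40 : 0 < e / 4 by rewrite divr_gt0.
have [l hl] := inf_convolution_approx (@cX n) cf e40.
have fb x : `|f x| <= supnorm f by exact: (le_supnorm (@cX n)).
pose h : X n -> R := inf_convolution l f.
have hlip := inf_convolution_lipschitz fb l.
have hb x : - supnorm f - e / 4 <= h x.
  have /andP[+ _] := hl x; rewrite -/(h x).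
  by have := fb x; rewrite ler_norml => /andP[+ _]; lra.
have [c qh] := @lipschitz_qcone n h l%:R (- supnorm f - e / 4) (ler0n _ _) hlip
  hb.
pose s := supnorm (fun x => h x + c).
have s0 : 0 <= s by apply: (supnorm_ge0 (@cX n)); case: qh.
have /andP[th0 th1] := contraction_gain01.
have [j je] : exists j, (1 - contraction_gain) ^+ j * s <= e / 2.
  have th : `|1 - contraction_gain| < 1 by rewrite ger0_norm ?subr_ge0 ?ltW//
    ltrBlDr ltrDl.
  have es : 0 < e / 2 / (s + 1) by rewrite !divr_gt0// ltr_wpDl.
  have /cvgr0Pnorm_lt/(_ _ es) [N _ /(_ N (leqnn N))] := cvg_expr th.
  rewrite ger0_norm ?exprn_ge0 ?subr_ge0 ?ltW// => hN; exists N.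
  have s1 : 0 < s + 1 by rewrite ltr_wpDl.
  rewrite ltr_pdivlMr// in hN; apply: le_trans (ltW hN).
  by rewrite ler_wpM2l ?exprn_ge0 ?subr_ge0 ?ltW// ltrDl.
have [A [lA uA]] := @ratio_bounds_qcone n (j * tau) j _ qh (leqnn _).
exists (j * tau)%N, (A - c); split=> z.
  have := lA z; rewrite iterL_shift.
  have : L n (j * tau) h z <= L n (j * tau) f z.
    by apply: le_iterL => x; have /andP[] := hl x.
  have := iterL1_gt0 z; lra.
have uAz := uA z; rewrite iterL_shift in uAz.
have fh : L n (j * tau) f z <= L n (j * tau) (fun x => h x + e / 4) z.
  by apply: le_iterL => x; have /andP[] := hl x; rewrite -/(h x); lra.
rewrite iterL_shift in fh.
have z0 := iterL1_gt0 z.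
have : (1 - contraction_gain) ^+ j * s * L n (j * tau) (one n) z <=
  e / 2 * L n (j * tau) (one n) z by rewrite ler_wpM2r// ltW.
rewrite -/s in uAz; have := mulr_gt0 e0 z0; lra.
Qed.

(** The common limit of the ratios [L^k f / L^k 1], see [pairing_ratio_cvg].
    Lower bounds on the ratio persist, so their supremum defines it without
    reference to a sequence of points. *)
Definition limit_ratio n (f : X n -> R) :=
  sup [set a | exists k, ratio_lb n k f a].

Arguments limit_ratio n f : clear implicits.

Lemma ratio_lb0 n (f : X n -> R) : continuous f -> ratio_lb n 0 f (- supnorm f).
Proof.
move=> cf z /=; rewrite mulr1.
by have := le_supnorm (@cX n) z cf; rewrite ler_norml => /andP[].
Qed.

Lemma ratio_ub0 n (f : X n -> R) : continuous f -> ratio_ub n 0 f (supnorm f).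
Proof.
move=> cf z /=; rewrite mulr1.
by have := le_supnorm (@cX n) z cf; rewrite ler_norml => /andP[].
Qed.

Lemma ratio_lb_le_limit n k (f : X n -> R) a : continuous f ->
  ratio_lb n k f a -> a <= limit_ratio n f.
Proof.
move=> cf fa; apply: ub_le_sup; last by exists k.
exists (supnorm f) => b [k' fb]; exact: ratio_lb_le_ub fb (ratio_ub0 cf).
Qed.

Lemma limit_le_ratio_ub n k (f : X n -> R) b : continuous f ->
  ratio_ub n k f b -> limit_ratio n f <= b.
Proof.
move=> cf fb; apply: ge_sup; first by exists (- supnorm f), 0%N;
  exact: ratio_lb0.
by move=> a [k' fa]; exact: ratio_lb_le_ub fa fb.
Qed.

Lemma ratio_lbD n k f g a b : ratio_lb n k f a -> ratio_lb n k g b ->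
  ratio_lb n k (fun x => f x + g x) (a + b).
Proof. by move=> fa gb z; rewrite iterLD mulrDl lerD. Qed.

Lemma ratio_ubD n k f g a b : ratio_ub n k f a -> ratio_ub n k g b ->
  ratio_ub n k (fun x => f x + g x) (a + b).
Proof. by move=> fa gb z; rewrite iterLD mulrDl lerD. Qed.

Lemma limit_ratioD n (f g : X n -> R) : continuous f -> continuous g ->
  limit_ratio n (fun x => f x + g x) = limit_ratio n f + limit_ratio n g.
Proof.
move=> cf cg; have cfg := continuous_add cf cg.
apply/eqP; rewrite -subr_eq0 -normr_le0; apply/ler_addgt0Pr => e e0.
have e2 : 0 < e / 2 by rewrite divr_gt0.
have [k [a [fa fb]]] := ratio_bounds_continuous cf e2.
have [k' [a' [ga gb]]] := ratio_bounds_continuous cg e2.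
have {}fa := ratio_lb_mono (leq_maxl k k') fa.
have {}fb := ratio_ub_mono (leq_maxl k k') fb.
have {}ga := ratio_lb_mono (leq_maxr k k') ga.
have {}gb := ratio_ub_mono (leq_maxr k k') gb.
have := ratio_lb_le_limit cf fa; have := ratio_lb_le_limit cg ga.
have := limit_le_ratio_ub cf fb; have := limit_le_ratio_ub cg gb.
have := ratio_lb_le_limit cfg (ratio_lbD fa ga); have :=
  limit_le_ratio_ub cfg (ratio_ubD fb gb).
rewrite add0r ler_norml => *; apply/andP; split; lra.
Qed.

Lemma ratio_lbZ n k f a c : 0 <= c -> ratio_lb n k f a ->
  ratio_lb n k (fun x => c * f x) (c * a).
Proof. by move=> c0 fa z; rewrite iterLZ -mulrA ler_wpM2l. Qed.

Lemma ratio_ubZ n k f a c : 0 <= c -> ratio_ub n k f a ->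
  ratio_ub n k (fun x => c * f x) (c * a).
Proof. by move=> c0 fa z; rewrite iterLZ -mulrA ler_wpM2l. Qed.

Lemma limit_ratio_ge0 n (f : X n -> R) : continuous f ->
  (forall x, 0 <= f x) -> 0 <= limit_ratio n f.
Proof.
move=> cf f0; apply: (@ratio_lb_le_limit n 0%N) => // z.
by rewrite mul0r iterL_ge0.
Qed.

Lemma limit_ratio_cst n c : limit_ratio n (fun=> c) = c.
Proof.
apply/eqP; rewrite eq_le (@limit_le_ratio_ub n 0%N)/=; last 2 first.
- exact: continuous_cst.
- by move=> z /=; rewrite mulr1.
apply: (@ratio_lb_le_limit n 0%N); first exact: continuous_cst.
by move=> z /=; rewrite mulr1.
Qed.

Lemma limit_ratioZ n c (f : X n -> R) : continuous f ->
  limit_ratio n (fun x => c * f x) = c * limit_ratio n f.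
Proof.
have pos d (h : X n -> R) : 0 <= d -> continuous h ->
  limit_ratio n (fun x => d * h x) = d * limit_ratio n h.
  move=> d0 ch; have cdh := @continuous_scale _ _ d _ ch.
  apply/eqP; rewrite -subr_eq0 -normr_le0; apply/ler_addgt0Pr => e e0.
  have d1 : 0 < d + 1 by rewrite ltr_wpDl.
  have e1 : 0 < e / (d + 1) by rewrite divr_gt0.
  have [k [a [fa fb]]] := ratio_bounds_continuous ch e1.
  have := ratio_lb_le_limit cdh (ratio_lbZ d0 fa); have :=
    limit_le_ratio_ub cdh (ratio_ubZ d0 fb).
  have := ler_wpM2l d0 (ratio_lb_le_limit ch fa); have :=
    ler_wpM2l d0 (limit_le_ratio_ub ch fb).
  have : d * (e / (d + 1)) <= e.
    by rewrite mulrCA ger_pMr// ler_pdivrMr// mul1r lerDl.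
  rewrite !mulrDr add0r ler_norml => *; apply/andP; split; lra.
move=> cf; case: (lerP 0 c) => [c0|/ltW c0]; first exact: pos.
have cNf := @continuous_scale _ _ (- c) _ cf.
have c1f := @continuous_scale _ _ c _ cf.
have := limit_ratioD cNf c1f.
rewrite pos ?oppr_ge0//.
have -> : (fun x => - c * f x + c * f x) = fun=> 0.
  by apply/funext => x; rewrite mulNr addNr.
by rewrite limit_ratio_cst => /esym/eqP; rewrite mulNr addrC subr_eq0 => /eqP.
Qed.

Lemma limit_ratio_positive n : positive_functional (limit_ratio n).
Proof. by split; [exact: limit_ratioD|exact: limit_ratioZ|exact:
  limit_ratio_ge0]. Qed.

(** If the functionals satisfy [limit_ratio (L f) = c * limit_ratio f], then
    taking [f = 1] shows that [c] is this number. *)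
Definition conformal_factor n := limit_ratio n.+1 (L1 n (one n)).

Lemma expRN_le_opL1 n z : expR (- V) <= L1 n (one n) z.
Proof.
have [y <-] := fib_neq0 (@fibre n) z.
apply: le_trans (transfer_ge (@fibre n) (@phi_bounded n) y _).
  by rewrite mulr1.
by move=> x; exact: ler01.
Qed.

Lemma opL1_le n z : L1 n (one n) z <= D%:R * expR V.
Proof.
by rewrite -[leRHS]mulr1; apply: (transfer_le (@fibre n) (@phi_bounded n)).
Qed.

Lemma conformal_factor_ge n : expR (- V) <= conformal_factor n.
Proof.
apply: (@ratio_lb_le_limit n.+1 0%N) => [|z /=].
  by apply: opL_continuous; exact: continuous_cst.
by rewrite mulr1 expRN_le_opL1.
Qed.

Lemma conformal_factor_gt0 n : 0 < conformal_factor n.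
Proof. exact: lt_le_trans (expR_gt0 _) (conformal_factor_ge n). Qed.

(** If [a] bounds from below the ratio of [f] after [k.+1] steps, then
    [L f - a * L 1] has a non-negative image under [L^k], and therefore a
    non-negative limit; similarly from above. *)
Lemma limit_ratio_opL n (f : X n -> R) : continuous f ->
  limit_ratio n.+1 (L1 n f) = conformal_factor n * limit_ratio n f.
Proof.
move=> cf; have c1 : continuous (one n) by exact: continuous_cst.
have cLf := opL_continuous cf; have cL1 := opL_continuous c1.
have posL := limit_ratio_positive n.+1.
apply/eqP; rewrite -subr_eq0 -normr_le0; apply/ler_addgt0Pr => e e0.
have l0 := conformal_factor_gt0 n.
have e1 : 0 < e / conformal_factor n by rewrite divr_gt0.
have [k [a [fa fb]]] := ratio_bounds_continuous cf e1.
have {}fa := ratio_lb_mono (leqnSn k) fa; have {}fb :=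
  ratio_ub_mono (leqnSn k) fb.
have := ler_wpM2l (ltW l0) (ratio_lb_le_limit cf fa).
have := ler_wpM2l (ltW l0) (limit_le_ratio_ub cf fb).
have h1 : a * conformal_factor n <= limit_ratio n.+1 (L1 n f).
  rewrite -limit_ratioZ// -subr_ge0 -(functionalB posL)//;
    last exact: continuous_scale.
  apply: (@ratio_lb_le_limit n.+1 k); first by apply: continuous_sub => //;
    exact: continuous_scale.
  move=> z; rewrite mul0r.
  have -> : (fun x => L1 n f x - a * L1 n (one n) x) =
      fun x => L1 n f x + (- a) * L1 n (one n) x.
    by apply/funext => x; rewrite mulNr.
  rewrite iterLD iterLZ mulNr subr_ge0; exact: fa.
have h2 : limit_ratio n.+1 (L1 n f) <=
  (a + e / conformal_factor n) * conformal_factor n.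
  set b := a + _ in fb *.
  rewrite -limit_ratioZ// -subr_ge0 -(functionalB posL)//;
    last exact: continuous_scale.
  apply: (@ratio_lb_le_limit n.+1 k); first by apply: continuous_sub => //;
    exact: continuous_scale.
  move=> z; rewrite mul0r.
  have -> : (fun x => b * L1 n (one n) x - L1 n f x) =
      fun x => b * L1 n (one n) x + (- 1) * L1 n f x.
    by apply/funext => x; rewrite mulN1r.
  rewrite iterLD !iterLZ mulN1r subr_ge0; exact: fb.
have -> : conformal_factor n * (a + e / conformal_factor n) =
  conformal_factor n * a + e.
  by field; rewrite gt_eqF.
rewrite mulrDl divfK ?gt_eqF// in h2.
rewrite add0r ler_norml => *; apply/andP; split; lra.
Qed.


(** * Conformal measures *)

Lemma iterL_pairing_positive n k
  (sigma : {finite_measure set (borel (X (adv n k))) -> \bar R}) :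
  positive_functional (fun f => pairing (L n k f) sigma).
Proof.
have soo := finite_measure_lty sigma; split.
- move=> f g cf cg; rewrite -(pairingD (@cX _))//; try exact: iterL_continuous.
  by congr pairing; apply/funext => z; rewrite iterLD.
- move=> c f cf; rewrite -(pairingZ (@cX _))//; try exact: iterL_continuous.
  by congr pairing; apply/funext => z; rewrite iterLZ.
- by move=> f cf f0; apply: pairing_ge0; exact: iterL_ge0.
Qed.

Lemma pairing_iterL1_gt0 n k
  (sigma : {finite_measure set (borel (X (adv n k))) -> \bar R}) :
  nonzero sigma -> 0 < pairing (L n k (one n)) sigma.
Proof.
move=> s0; apply: (pairing_gt0 (@cX _)) => //.
- exact: finite_measure_lty.
- by apply: iterL_continuous; exact: continuous_cst.
- by move=> z; exact: iterL1_gt0.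
Qed.

Lemma pairing_ratio_bounds n k f a b
  (sigma : {finite_measure set (borel (X (adv n k))) -> \bar R}) :
  nonzero sigma -> continuous f -> ratio_lb n k f a -> ratio_ub n k f b ->
  a <= pairing (L n k f) sigma / pairing (L n k (one n)) sigma <= b.
Proof.
move=> s0 cf fa fb; have p0 := pairing_iterL1_gt0 s0.
have soo := finite_measure_lty sigma.
have c1 : continuous (one n) by exact: continuous_cst.
have cL1 := @iterL_continuous n k _ c1; have cLf := @iterL_continuous n k _ cf.
rewrite ler_pdivlMr// ler_pdivrMr// -!(pairingZ (@cX _))//.
by rewrite !(le_pairing (@cX _))//; exact: continuous_scale.
Qed.

Lemma pairing_ratio_limit n k f a b
  (sigma : {finite_measure set (borel (X (adv n k))) -> \bar R}) :
  nonzero sigma -> continuous f -> ratio_lb n k f a -> ratio_ub n k f b ->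
  `|limit_ratio n f - pairing (L n k f) sigma / pairing (L n k (one n)) sigma|
    <= b - a.
Proof.
move=> s0 cf fa fb; have /andP[] := pairing_ratio_bounds s0 cf fa fb.
have := ratio_lb_le_limit cf fa; have := limit_le_ratio_ub cf fb.
by move=> *; rewrite ler_norml; apply/andP; split; lra.
Qed.

Lemma pairing_ratio_cvg n f
  (sigma : forall k, {finite_measure set (borel (X (adv n k))) -> \bar R}) :
  (forall k, nonzero (sigma k)) -> continuous f ->
  (fun k => pairing (L n k f) (sigma k) / pairing (L n k (one n)) (sigma k))
    @ \oo --> limit_ratio n f.
Proof.
move=> s0 cf; apply/cvgrPdist_le => e e0.
have [k [a [fa fb]]] := ratio_bounds_continuous cf e0.
exists k => // k' /= kk'.
have := pairing_ratio_limit (s0 k') cf (ratio_lb_mono kk' fa) (ratio_ub_mono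
  kk' fb).
by rewrite addrAC subrr add0r.
Qed.

Lemma dual_iterL n k f
  (sigma : {finite_measure set (borel (X (adv n k))) -> \bar R}) :
  continuous f -> pairing f (dual (L n k) sigma) = pairing (L n k f) sigma.
Proof.
by move=> cf; apply: (dualP (@cX n) (iterL_pairing_positive sigma)).
Qed.

Lemma dual_opL n f
  (sigma : {finite_measure set (borel (X n.+1)) -> \bar R}) :
  continuous f -> pairing f (dual (L1 n) sigma) = pairing (L1 n f) sigma.
Proof. exact: (@dual_iterL n 1). Qed.

Lemma normalized_dual n k f
  (sigma : {finite_measure set (borel (X (adv n k))) -> \bar R}) :
  continuous f ->
  pairing f (normalized (dual (L n k) sigma)) =
  pairing (L n k f) sigma / pairing (L n k (one n)) sigma.
Proof.
move=> cf; have c1 : continuous (one n) by exact: continuous_cst.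
by rewrite (pairing_normalized (@cX n)) ?finite_measure_lty// !dual_iterL.
Qed.

(** Integrals of continuous functions determine the measures; the sign of [c]
    comes from the total masses. *)
Lemma proportionalP n c (m m' : {finite_measure set (borel (X n)) -> \bar R}) :
  (0 < m' setT)%E -> proportional c m m' <->
  0 <= c /\ forall f, continuous f -> pairing f m = c * pairing f m'.
Proof.
have moo := finite_measure_lty m; have m'oo := finite_measure_lty m'.
have scale_oo (r : {nonneg R}) : (mscale r m' setT < +oo)%E.
  by rewrite /mscale/= lte_mul_pinfty.
move=> m'0; split=> [mm'|[c0 mm'] A mA]; last first.
  rewrite (@measure_ext _ _ (@cX n) m (mscale (NngNum c0) m') moo (scale_oo
    _))//
    => f cf.
  by rewrite (pairing_mscale (@cX n))// mm'.
have c0 : 0 <= c.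
  exact: scale_ge0 m'0 m'oo (mm' _ measurableT).
split=> // f cf.
rewrite (_ : c * _ = pairing f (mscale (NngNum c0) m')).
  by apply: eq_pairing => A mA; rewrite mm'.
by rewrite (pairing_mscale (@cX n)).
Qed.

Section ConformalMeasures.
Variable m : forall n, probability (borel (X n)) R.
Hypothesis mE : forall n f, continuous f -> pairing f (m n) = limit_ratio n f.

Lemma pairing1_probability n (P : probability (borel (X n)) R) :
  pairing (one n) P = 1.
Proof. by rewrite pairing1; exact: (congr1 fine (probability_setT P)). Qed.

Lemma conformal n : proportional (conformal_factor n) (dual (L1 n) (m n.+1)) (m
  n).
Proof.
apply/proportionalP; first exact: probability_setT_gt0.
split=> [|f cf]; first exact/ltW/conformal_factor_gt0.
by rewrite dual_opL// !mE ?limit_ratio_opL//; exact: opL_continuous.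
Qed.

(** Conformality of [m'] gives [pairing (L^k f) (m' (n + k)) = c * pairing f (m' n)]
    with the same [c] for all [f].  Hence [pairing f (m' n)] is a ratio of
    pairings, which lies between the same bounds as [limit_ratio f]. *)
Lemma conformal_unique (m' : forall n, probability (borel (X n)) R) :
  (forall n, exists c, proportional c (dual (L1 n) (m' n.+1)) (m' n)) ->
  forall n (A : set (borel (X n))), measurable A -> m' n A = m n A.
Proof.
move=> m'c.
have iter_conf n k : exists c, forall f, continuous f ->
    pairing (L n k f) (m' (adv n k)) = c * pairing f (m' n).
  elim: k n => [|k IH] n; first by exists 1 => f _ /=; rewrite mul1r.
  have [c hc] := IH n.+1; have [d /proportionalP hd] := m'c n.
  have {}hd := (hd (probability_setT_gt0 _)).2.
  exists (c * d) => f cf /=; rewrite hc; last exact: opL_continuous.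
  by rewrite -mulrA -hd// dual_opL.
move=> n; apply: (measure_ext (@cX n) (finite_measure_lty _)
  (finite_measure_lty _)) => f cf.
suff m'E : pairing f (m' n) =
  limit_ratio n f by exact: etrans m'E (esym (mE cf)).
apply/eqP; rewrite eq_sym -subr_eq0 -normr_le0.
apply/ler_addgt0Pr => e e0.
have [k [a [fa fb]]] := ratio_bounds_continuous cf e0.
have := pairing_ratio_limit (probability_setT_gt0 (m' (adv n k))) cf fa fb.
have p0 := pairing_iterL1_gt0 (probability_setT_gt0 (m' (adv n k))).
have [c hc] := iter_conf n k.
have c1 : continuous (one n) by exact: continuous_cst.
have hc1 := hc _ c1; rewrite pairing1_probability mulr1 in hc1.
rewrite hc1 in p0.
rewrite hc// hc1 mulrAC divff ?gt_eqF// mul1r.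
by rewrite add0r addrAC subrr add0r.
Qed.

Definition decay_rate : R := (1 - contraction_gain) `^ (tau%:R^-1).

Lemma decay_rate01 : 0 < decay_rate < 1.
Proof.
have /andP[th0 th1] := contraction_gain01.
have e1 : 1 = 1 `^ (tau%:R^-1) :> R by rewrite powR1.
rewrite powR_gt0 ?subr_gt0//= [ltRHS]e1; apply: gt0_ltr_powR.
- by rewrite invr_gt0 ltr0n.
- by rewrite nnegrE subr_ge0 ltW.
- by rewrite nnegrE.
- by rewrite ltrBlDr ltrDl.
Qed.

(** Write [k = j * tau + r] with [r < tau]: replacing [decay_rate ^+ r] by the
    smaller [decay_rate ^+ tau = 1 - contraction_gain] costs the constant. *)
Lemma decay_rate_bound k : (1 - contraction_gain) ^+ (k %/ tau) <=
  (1 - contraction_gain)^-1 * decay_rate ^+ k.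
Proof.
have /andP[th0 th1] := contraction_gain01; have /andP[g0 g1] := decay_rate01.
have th : 0 < 1 - contraction_gain by rewrite subr_gt0.
have gt : decay_rate ^+ tau = 1 - contraction_gain.
  rewrite -powR_mulrn ?(ltW g0)// -powRrM mulVf ?powRr1 ?(ltW th)//.
  by rewrite pnatr_eq0 -lt0n.
rewrite ler_pdivlMl// {2}(divn_eq k tau) exprD mulnC exprM gt mulrC.
rewrite ler_wpM2l ?exprn_ge0 ?(ltW th)// -gt.
by rewrite ler_wiXn2l ?(ltW g0) ?(ltW g1)// ltnW// ltn_pmod.
Qed.

Lemma ln_lipschitz (c x y : R) : 0 < c -> c <= x -> c <= y ->
  `|ln x - ln y| <= c^-1 * `|x - y|.
Proof.
move=> c0; suff h u v : c <= u -> c <= v -> ln u - ln v <= c^-1 * `|u - v|.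
  by move=> cx cy; rewrite ler_norml lerNl opprB h//= distrC h.
move=> cu cv; have u0 := lt_le_trans c0 cu; have v0 := lt_le_trans c0 cv.
rewrite -ln_div ?posrE// -[u / v](subrK 1) addrC.
apply: le_trans (le_ln1Dx _) _.
  by rewrite ltrBrDl subrr divr_gt0.
have -> : u / v - 1 = (u - v) / v by field; rewrite gt_eqF.
apply: (@le_trans _ _ (`|u - v| / v)).
  by rewrite ler_wpM2r ?invr_ge0 ?(ltW v0)// ler_norm.
by rewrite mulrC ler_wpM2r// lef_pV2.
Qed.

Lemma pairing_ratio_rate n k f
  (sigma : {finite_measure set (borel (X (adv n k))) -> \bar R}) :
  nonzero sigma -> cone Q f ->
  `|limit_ratio n f - pairing (L n k f) sigma / pairing (L n k (one n)) sigma|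
    <= (1 - contraction_gain)^-1 * supnorm f * decay_rate ^+ k.
Proof.
move=> s0 qf; have cf : continuous f by case: qf.
have [A [fA fB]] := ratio_bounds_qcone qf (leq_divM k tau).
apply: le_trans (pairing_ratio_limit s0 cf fA fB) _.
rewrite addrAC subrr add0r mulrAC ler_wpM2r ?decay_rate_bound//.
exact: (supnorm_ge0 (@cX n)).
Qed.

(** The quotient is the ratio of pairings of [L 1] started one step later.  It is
    at least [expR (- V)], as is its limit, and above that value the logarithm
    is Lipschitz. *)
Lemma conformal_factor_rate n k
  (sigma : {finite_measure set (borel (X (adv n k.+1))) -> \bar R}) :
  nonzero sigma ->
  `|ln (conformal_factor n) - ln (pairing (L n k.+1 (one n)) sigma /
                     pairing (L n.+1 k (one n.+1)) sigma)|
    <= expR V * ((1 - contraction_gain)^-1 * (D%:R * expR V)) * decay_rate^-1 *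
      decay_rate ^+ k.+1.
Proof.
move=> s0; have /andP[g0 g1] := decay_rate01; have /andP[th0 th1] :=
  contraction_gain01.
have c1 : continuous (one n) by exact: continuous_cst.
have cL1 := opL_continuous c1.
have qL : cone Q (L1 n (one n)).
  apply: qcone_mono (opL_qcone (qcone1 n)).
  by rewrite ler_piMl ?(ltW Q0)//; case/andP: q01 => _ /ltW.
have lbV : ratio_lb n.+1 k (L1 n (one n)) (expR (- V)).
  by apply: (@ratio_lb_mono n.+1 0) => // z /=; rewrite mulr1 expRN_le_opL1.
have [A [_ upA]] := ratio_bounds_qcone qL (leq_divM k tau).
have /andP[r0 _] := @pairing_ratio_bounds n.+1 k _ _ _ sigma s0 cL1 lbV upA.
apply: le_trans (ln_lipschitz (expR_gt0 _) (conformal_factor_ge n) r0) _.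
rewrite expRN invrK -!mulrA ler_wpM2l ?expR_ge0//.
apply: le_trans (@pairing_ratio_rate n.+1 k _ sigma s0 qL) _.
rewrite exprS (mulrA decay_rate^-1) mulVf ?gt_eqF// mul1r -mulrA.
rewrite ler_wpM2l ?invr_ge0 ?subr_ge0 ?(ltW th1)// mulrA.
rewrite ler_wpM2r ?exprn_ge0 ?(ltW g0)//.
apply: supnorm_le => z.
by rewrite ger0_norm ?opL1_le// (le_trans (expR_ge0 _) (expRN_le_opL1 z)).
Qed.

End ConformalMeasures.

End Iterates.

Theorem theoremI (R : realType) (X : nat -> pointedMetricType R)
  (T : forall n, X n -> X n.+1) (phi : forall n, X n -> R)
  (D tau : nat) (delta rho H beta V : R)
  (phi_cont : forall n, continuous (@phi n))
  (A1 : condA1 T D) (A2 : condA2 T delta rho) (A3 : condA3 T delta tau)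
  (A4 : condA4 phi delta H beta V) :
  exists Q0 : R, forall Q : R, 0 < Q -> Q0 <= Q ->
  exists (lambda : nat -> R) (m : forall n, probability (borel (X n)) R),
  [/\ (* A *)
      forall (n : nat)
        (sigma : forall l, {finite_measure set (borel (X l)) -> \bar R}),
        (forall l, (n <= l)%N -> nonzero (sigma l)) ->
        (fun k => pairing (iterL T phi n k.+1 (const1 (X n)))
                          (sigma (adv n k.+1)) /
                  pairing (iterL T phi n.+1 k (const1 (X n.+1)))
                          (sigma (adv n.+1 k))) @ \oo --> lambda n /\
        weakstar_cvg
          (fun k => normalized (dual (iterL T phi n k) (sigma (adv n k))))
          (m n),
      (* B *)
      (forall n, 0 < lambda n) /\
      (forall n, proportional (lambda n)
        (dual (opL T phi n) (m n.+1)) (m n)),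
      (* C *)
      (forall n, exists c : R, proportional c
        (dual (opL T phi n) (m n.+1)) (m n)) /\
      (forall m' : forall n, probability (borel (X n)) R,
        (forall n, exists c : R, proportional c
          (dual (opL T phi n) (m' n.+1)) (m' n)) ->
        forall n (A : set (borel (X n))), measurable A -> m' n A = m n A) &
      (* D *)
      exists C1 gamma : R, [/\ 0 < C1, 0 < gamma < 1 &
        forall (n k : nat), (tau <= k.+1)%N ->
        forall sigma : {finite_measure set (borel (X (adv n k.+1))) -> \bar R},
        nonzero sigma ->
        forall f, cone delta beta Q f ->
        `|ln (lambda n) -
          ln (pairing (iterL T phi n k.+1 (const1 (X n))) sigma /
              pairing (iterL T phi n.+1 k (const1 (X n.+1))) sigma)|
          <= C1 * gamma ^+ k.+1 /\
        `|pairing f (m n) -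
          pairing f (dual (iterL T phi n k.+1) sigma) /
          pairing (const1 (X n)) (dual (iterL T phi n k.+1) sigma)|
          <= C1 * supnorm f * gamma ^+ k.+1]].
Proof.
have [b0 b1] : 0 < beta /\ beta < 1 by case: A4 => _ /andP[].
have [r0 r1] : 0 < rho /\ rho < 1 by case: A2 => _ /andP[].
have rb1 : rho `^ beta < 1.
  have e1 : 1 = 1 `^ beta :> R by rewrite powR1.
  rewrite [ltRHS]e1; apply: gt0_ltr_powR => //; rewrite nnegrE ?ler01 ?ltW//.
have rb0 : 0 <= rho `^ beta by exact: powR_ge0.
(* Any [q] strictly between [rho `^ beta] and 1 would do; [Q0] then makes the
   constant terms [B] of [image_regularity] at most [(q - rho `^ beta) * Q]. *)
pose q := (1 + rho `^ beta) / 2.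
have q01 : 0 < q < 1 by apply/andP; split; rewrite /q; lra.
pose B := rho `^ beta * H + ln D%:R / (delta / 2) `^ beta.
exists (2 * B / (1 - rho `^ beta)) => Q Q0 QB.
have Qq : image_regularity D delta rho H beta Q <= q * Q.
  rewrite ler_pdivrMr ?subr_gt0// in QB.
  rewrite /image_regularity /q; move: QB; rewrite /B; lra.
have mEx n : exists P : probability (borel (X n)) R,
    forall f, continuous f -> pairing f P = limit_ratio T phi f.
  apply: riesz_probability; first by case: A1.
    exact: (limit_ratio_positive phi_cont A1 A2 A3 A4 Q0 q01 Qq).
  exact: (limit_ratio_cst phi_cont A1 A4).
pose m n := projT1 (cid (mEx n)).
have mE n f : continuous f -> pairing f (m n) = limit_ratio T phi f.
  by move=> cf; rewrite /m; case: cid => P /= ->.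
have cone1 n : continuous (const1 (X n)) by exact: continuous_cst.
exists (conformal_factor T phi), m; split.
- move=> n sigma s0.
  have sk k : nonzero (sigma (adv n k)) by apply: s0; rewrite advE leq_addr.
  split.
    apply: (pairing_ratio_cvg phi_cont A1 A2 A3 A4 Q0 q01 Qq
      (sigma := fun k => sigma (adv n.+1 k))); first by move=> k;
        exact: (sk k.+1).
    exact: (opL_continuous phi_cont A1 A2).
  move=> f cf; rewrite mE//.
  under eq_fun do rewrite (normalized_dual phi_cont A1 A2)//.
  exact: (pairing_ratio_cvg phi_cont A1 A2 A3 A4 Q0 q01 Qq).
- split=> n; first exact: (conformal_factor_gt0 phi_cont A1 A2 A4).
  exact: (conformal phi_cont A1 A2 A3 A4 Q0 q01 Qq mE).
- split=> [n|m' m'c n A mA].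
    by exists (conformal_factor T phi n);
      exact: (conformal phi_cont A1 A2 A3 A4 Q0 q01 Qq mE).
  exact: (conformal_unique phi_cont A1 A2 A3 A4 Q0 q01 Qq mE m'c).
set th := contraction_gain D tau delta beta V Q q; set g :=
  decay_rate D tau delta beta V Q q.
have /andP[th0 th1] : 0 < th < 1 by exact: (contraction_gain01 tau A1 A4 Q0
  q01).
have g01 : 0 < g < 1 by exact: (decay_rate01 A1 A3 A4 Q0 q01).
have g0 : 0 < g by case/andP: g01.
pose C := expR V * ((1 - th)^-1 * (D%:R * expR V)) / g.
have C0 : 0 <= C.
  by rewrite !mulr_ge0 ?expR_ge0 ?invr_ge0 ?subr_ge0 ?(ltW th1) ?(ltW g0).
have i0 : 0 < (1 - th)^-1 by rewrite invr_gt0 subr_gt0.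
exists (C + (1 - th)^-1), g; split=> [||n k _ sigma s0 f [cf f0 _ fQ]] //.
  by rewrite ltr_wpDl.
split.
  apply: le_trans (conformal_factor_rate phi_cont A1 A2 A3 A4 Q0 q01 Qq s0) _.
  by rewrite ler_wpM2r ?exprn_ge0 ?(ltW g0)// lerDl ltW.
rewrite mE// !(dual_iterL phi_cont A1 A2)//.
have qf : qcone delta beta Q f by split.
apply: le_trans (pairing_ratio_rate phi_cont A1 A2 A3 A4 Q0 q01 Qq s0 qf) _.
rewrite ler_wpM2r ?exprn_ge0 ?(ltW g0)// ler_wpM2r ?lerDr//.
by apply: supnorm_ge0 => //; case: A1.
Qed.
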